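(* Let $n\in\mathbb N$, $z_1,\dots,z_n\in\mathbb C$ (no further assumptions), and $\rho_n(z)=\sum_{k=1}^n\frac1{z-z_k}$. Let $1<p<q\le\infty$, let $p',q'$ be defined by $\frac1p+\frac1{p'}=1$, $\frac1q+\frac1{q'}=1$, and let $m_p$ be the integer in $\mathbb N\cap[\tfrac p2,1+\tfrac p2)$. Then $$\|\rho_n\|_{L^q(\mathbb R)}^{q'}\le 2^{\,q'-p'}\left(\frac{m_p}{\pi}\right)^{p'q'\left(\frac1p-\frac1q\right)}(1+h_p)^{p'}\,\|\rho_n\|_{L^p(\mathbb R)}^{p'},$$ where $h_p=\tan\frac{\pi}{2p}$ for $1<p\le2$ and $h_p=\cot\frac{\pi}{2p}$ for $2\le p<\infty$ (the norm of the Hilbert transform on $L^p(\mathbb R)$).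
   Context: $\|\cdot\|_{L^p(\mathbb R)}$ is the usual $L^p$-norm with respect to Lebesgue measure, with the value $+\infty$ allowed; $1/\infty=0$, so $q'=1$ when $q=\infty$. *)

(* Defs.v *)
From HB Require Import structures.
From mathcomp Require Import all_boot all_order all_algebra.
From mathcomp Require Import all_classical all_reals all_analysis.
From mathcomp Require Import complex.

Set Implicit Arguments.
Unset Strict Implicit.
Unset Printing Implicit Defensive.

Import Order.TTheory GRing.Theory Num.Theory.
Import numFieldNormedType.Exports.

Local Open Scope ring_scope.
Local Open Scope complex_scope.

(* The value at a pole is a junk value (0^-1 = 0); the norms below do not see
   it, as the poles form a Lebesgue-null set. *)
Definition rho (R : realType) (n : nat) (z : 'I_n -> R[i]) (w : R[i]) : R[i] :=
  \sum_(k < n) (w - z k)^-1.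

(* The L^q(R)-norm of the restriction to the real line of a function of a
   complex variable.  The order norm `|w| of w : R[i] lives in R[i], hence
   complex.Re to get the modulus as an element of R. *)
Definition line_Lnorm (R : realType) (q : \bar R) (f : R[i] -> R[i]) : \bar R :=
  Lnorm (@lebesgue_measure R) q (fun x : R => (complex.Re `|f x%:C|)%:E).

Definition cot (R : realType) (x : R) : R := cos x / sin x.

Definition hilbert_const (R : realType) (p : R) : R :=
  if p <= 2 then tan (pi / (2 * p)) else cot (pi / (2 * p)).

(* Main.v *)
(* If some z_k is real, both p-norms involved are infinite, as |rho| is of order
   1 / |x - z_k| near z_k.  Otherwise rho = F + conj G on the real line, where F
   and G are sums of 1 / (x - w) with all the w in the upper half-plane.  Such
   sums are holomorphic in the lower half-plane with values in the upper one.

   One-sided bound.  F^m is a rational function whose poles are those of F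
   repeated m times; expanding it in the orthogonal Malmquist-Takenaka functions
   gives |F(x)|^(2m) <= (m / pi) Im F(x) \int |F|^(2m).  For p <= 2m, comparing
   |F|^(2m) with (sup |F|)^(2m - p) |F|^p yields
   |F(x)|^(p - 1) <= (m / pi) \int |F|^p, and then all the q-norms of F.

   Riesz projection.  As F and G take values in the upper half-plane, the power
   (- F G)^(p / 2) is holomorphic, without zeros or branch cut, and its integral
   over the line vanishes.  Pichorides' trigonometric inequality gives
   |F - conj G|^p <= h^p |F + conj G|^p + b Re (- F G)^(p / 2) pointwise, hence
   by convexity \int |F|^p <= ((1 + h) / 2)^p \int |rho|^p, and likewise for G.
   The theorem follows from |rho| <= |F| + |G|. *)
Require Import Defs.
From mathcomp Require Import all_boot all_order all_algebra.
From mathcomp Require Import all_classical all_reals all_analysis.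
From mathcomp Require Import measurable_realfun ess_sup_inf complex.
From mathcomp Require Import ring lra.

Set Implicit Arguments.
Unset Strict Implicit.
Unset Printing Implicit Defensive.

Import Order.TTheory GRing.Theory Num.Theory.
Import numFieldNormedType.Exports.
Import Normc.

Local Open Scope classical_set_scope.
Local Open Scope ring_scope.

(** * Monotonicity and powers of the cosine *)

(** All poles are kept at height at least [2 * e] and all estimates are made at depths [y > - e], so
    the real line is interior to the region of holomorphy and no boundary values have to be taken.
    The obstacle in the projection step is the branch of the power: the argument of - F G may be
    anything in ]-pi, pi[, whereas - i F and - i G both stay in the right half-plane. The power is
    therefore the exponential of a sum of two logarithms, and the trigonometric inequality has to
    hold for all angles up to pi and all ratios |F| / |G|; the parameter C >= 1 below records that
    ratio. All comparisons are pointwise, so neither Minkowski's inequality nor any theory of Hardy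
    spaces enters. Origin of the constants: 1 / pi is the reciprocal of the mass of a Poisson
    kernel, m is the multiplicity of the repeated poles, and m >= p / 2 makes the exponent 2 m - p
    nonnegative. The factor 2^q' comes from adding two halves that obey the same bound; 2^(-p') and
    (1 + h)^p' are the constant (1 + h) / 2 raised to p / (p - 1) = p'. *)

Lemma derive_ge0_le (R : realType) (f df : R -> R) (a b : R) :
  a <= b ->
  (forall x, a <= x <= b -> is_derive x 1 f (df x)) ->
  (forall x, a <= x <= b -> 0 <= df x) -> f a <= f b.
Proof.
move=> ab fdf df0.
have cf : {within `[a, b], continuous f}.
  apply: derivable_within_continuous => x; rewrite in_itv/= => xab.
  by have [] := fdf _ xab.
have [|c cab fab] := @MVT_segment _ f df _ _ ab _ cf.
  by move=> x; rewrite in_itv/= => /andP[/ltW ax /ltW xb]; apply: fdf; rewrite ax.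
rewrite -subr_ge0 fab; apply: mulr_ge0; last by rewrite subr_ge0.
by apply: df0; move: cab; rewrite in_itv.
Qed.

Lemma derive_le0_ge (R : realType) (f df : R -> R) (a b : R) :
  a <= b ->
  (forall x, a <= x <= b -> is_derive x 1 f (df x)) ->
  (forall x, a <= x <= b -> df x <= 0) -> f b <= f a.
Proof.
move=> ab fdf df0; rewrite -lerN2.
apply: (@derive_ge0_le _ (- f) (fun x => - df x)) => // x xab.
  by have := fdf _ xab => fdfx; apply: is_deriveN.
by rewrite oppr_ge0 df0.
Qed.

(** The two terms of the product rule merge through the sine of a difference; for [a >= 0] the sign
    is opposite to that of [sin ((a - 1) * x)]. *)
Lemma is_derive_cosM_powR_cos (R : realType) (a x : R) : 0 < cos x ->
  is_derive x 1 (fun t => cos (a * t) * cos t `^ (- a))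
    (- a * sin ((a - 1) * x) * cos x `^ (- a - 1)).
Proof.
move=> cx.
have h1 : is_derive x 1 (fun t : R => a * t) (a *: 1) by apply: is_deriveZ.
have h2 : is_derive x 1 (fun t => cos (a * t)) (- sin (a * x) * a).
  have h := @is_derive1_comp _ (@cos R) (fun t : R => a * t) x _ _ (is_derive_cos _) h1.
  apply: is_derive_eq h _.
  by rewrite scaler1.
have h3 : is_derive x 1 (fun t => cos t `^ (- a)) (- a * cos x `^ (- a - 1) * (- sin x)).
  have h := @is_derive1_comp _ (fun y : R => y `^ (-a)) (@cos R) x _ _ (is_derive1_powR _ cx) (is_derive_cos _).
  by apply: is_derive_eq h _.
apply: is_derive_eq.
have -> : cos x `^ (- a) = cos x * cos x `^ (- a - 1).
  rewrite -[X in X * _]powRr1 ?ltW// -powRD.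
    by congr (_ `^ _); ring.
  by rewrite (gt_eqF cx) implybT.
rewrite mulrBl mul1r sinB -![_ *: _]/(_ * _).
by ring.
Qed.

Section cos_ratio.
Variables (R : realType) (a s t : R).
Hypotheses (s0 : 0 <= s) (st : s <= t) (tpi : t < pi / 2).

Let cos0 x : s <= x <= t -> 0 < cos x.
Proof.
move=> /andP[sx xt]; apply: cos_gt0_pihalf.
rewrite (le_lt_trans xt tpi) andbT (lt_le_trans _ (le_trans s0 sx))//.
by rewrite oppr_lt0 divr_gt0 ?pi_gt0.
Qed.

Let div_cos x u v : 0 < cos u -> 0 < cos v ->
  (x * cos u `^ (- a) <= cos (a * v) * cos v `^ (- a)) =
  (x * cos v `^ a <= cos (a * v) * cos u `^ a).
Proof.
move=> cu cv; rewrite !powRN ler_pdivrMr ?powR_gt0// mulrAC ler_pdivlMr ?powR_gt0//.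
Qed.

(** The derivative above is nonpositive as long as (a - 1) x stays in [0, pi]. This range goes
    beyond the first zero of cos (a x), as Pichorides' inequality requires. *)
Lemma cos_ratio_nincr : 1 <= a -> (a - 1) * t <= pi ->
  cos (a * t) * cos s `^ a <= cos (a * s) * cos t `^ a.
Proof.
move=> a1 apit.
have cs : 0 < cos s by apply: cos0; rewrite lexx.
have ct : 0 < cos t by apply: cos0; rewrite lexx andbT.
rewrite -div_cos//.
apply: (@derive_le0_ge _ (fun t => cos (a * t) * cos t `^ (- a))
  (fun x => - a * sin ((a - 1) * x) * cos x `^ (- a - 1)) s t st) => x sxt.
  exact: (is_derive_cosM_powR_cos a (cos0 sxt)).
move: (sxt) => /andP[sx xt].
rewrite mulNr mulNr oppr_le0 !mulr_ge0 ?powR_ge0//; first exact: le_trans a1.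
rewrite sin_ge0_pi// mulr_ge0 ?subr_ge0 ?(le_trans s0 sx)//=.
by apply: le_trans apit; rewrite ler_wpM2l ?subr_ge0.
Qed.

Lemma cos_ratio_ndecr : 0 <= a -> a <= 1 ->
  cos (a * s) * cos t `^ a <= cos (a * t) * cos s `^ a.
Proof.
move=> a0 a1.
have cs : 0 < cos s by apply: cos0; rewrite lexx.
have ct : 0 < cos t by apply: cos0; rewrite lexx andbT.
rewrite -div_cos//.
apply: (@derive_ge0_le _ (fun t => cos (a * t) * cos t `^ (- a))
  (fun x => - a * sin ((a - 1) * x) * cos x `^ (- a - 1)) s t st) => x sxt.
  exact: (is_derive_cosM_powR_cos a (cos0 sxt)).
move: (sxt) => /andP[sx xt].
rewrite mulr_ge0 ?powR_ge0// mulNr -mulrN mulr_ge0// -sinN -mulNr opprB.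
have x0 := le_trans s0 sx.
rewrite sin_ge0_pi// mulr_ge0 ?subr_ge0//=.
have xp : x <= pi.
  by apply: (le_trans xt); apply: (le_trans (ltW tpi)); have := pi_ge0 R; lra.
by apply: le_trans xp; rewrite ler_piMl//; lra.
Qed.

End cos_ratio.

(** * Inequalities for real powers *)

Section powR_inequalities.
Variable R : realType.
Implicit Types (x y a p w : R).

Lemma powR_conv_le p w x y : 1 <= p -> 0 <= w <= 1 -> 0 <= x -> 0 <= y ->
  (w * x + (1 - w) * y) `^ p <= w * x `^ p + (1 - w) * y `^ p.
Proof.
move=> p1 /andP[w0 w1] x0 y0.
have := @convex_powR R p p1 (Itv01 w0 w1) x y.
by rewrite !inE/= !in_itv/= !andbT => /(_ x0 y0); rewrite !convRE.
Qed.

(** Divided by [x + y], two positive terms become numbers of ]0, 1] with sum 1, and a power [a <= 1]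
    does not decrease such numbers. *)
Lemma powR_subadd a x y : 0 <= a <= 1 -> 0 <= x -> 0 <= y ->
  (x + y) `^ a <= x `^ a + y `^ a.
Proof.
move=> /andP[a0 a1]; rewrite le0r => /predU1P[->|x0].
  by rewrite add0r lerDr powR_ge0.
rewrite le0r => /predU1P[->|y0]; first by rewrite addr0 lerDl powR_ge0.
have s0 : 0 < x + y by rewrite addr_gt0.
have part z : 0 < z -> z <= x + y -> (x + y) `^ a * (z / (x + y)) <= z `^ a.
  move=> z0 zs; have u0 : 0 < z / (x + y) by rewrite divr_gt0.
  have -> : z `^ a = (x + y) `^ a * (z / (x + y)) `^ a.
    by rewrite -powRM ?(ltW u0) ?(ltW s0)// mulrC divfK ?gt_eqF.
  rewrite ler_wpM2l ?powR_ge0// ger1_powR// u0/=.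
  by rewrite ler_pdivrMr ?mul1r.
have := lerD (part x x0 _) (part y y0 _).
rewrite -mulrDr -mulrDl divff ?gt_eqF// mulr1; apply; rewrite ?lerDl ?lerDr; exact: ltW.
Qed.

(** Midpoint concavity of the power [a], read off from the convexity of the power [a^-1] at the
    points x^a and y^a. *)
Lemma powR_add_le a x y : 0 < a <= 1 -> 0 <= x -> 0 <= y ->
  x `^ a + y `^ a <= 2 `^ (1 - a) * (x + y) `^ a.
Proof.
move=> /andP[a0 a1] x0 y0.
have h01 : 0 <= (2^-1 : R) <= 1 by apply/andP; split; lra.
have := @powR_conv_le a^-1 2^-1 (x `^ a) (y `^ a).
rewrite invf_ge1// a1 h01 !powR_ge0 => /(_ isT isT isT isT).
rewrite -!powRrM divff ?gt_eqF// !powRr1// => h.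
have e : 2^-1 * x `^ a + (1 - 2^-1) * y `^ a = (x `^ a + y `^ a) / 2 by field.
have h2 : ((x `^ a + y `^ a) / 2) `^ a^-1 `^ a <= (2^-1 * x + (1 - 2^-1) * y) `^ a.
  have pos : 0 <= 2^-1 * x + (1 - 2^-1) * y by lra.
  apply: ge0_ler_powR; rewrite ?nnegrE ?powR_ge0 ?(ltW a0)//.
  by rewrite -e.
rewrite -powRrM mulVf ?gt_eqF// powRr1 ?divr_ge0 ?addr_ge0 ?powR_ge0// in h2.
rewrite (_ : 2^-1 * x + _ = (x + y) / 2) in h2; last by field.
rewrite powRM ?addr_ge0// ?invr_ge0// in h2.
rewrite powRD; last by rewrite pnatr_eq0 implybT.
rewrite powRr1// powRN mulrC mulrCA [leRHS]mulrC -ler_pdivrMr//.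
apply: le_trans h2 _; rewrite -[2^-1]powR_inv1// -!powRrM mulN1r powRN.
by rewrite mulrC.
Qed.

(** Young's inequality for the product of 2^s and 1 with exponents 1 / s and 1 / (1 - s), which
    gives 2 s + (1 - s). *)
Lemma powR2_le s : 0 <= s <= 1 -> 2 `^ s <= 1 + s :> R.
Proof.
move=> /andP[s0 s1].
have [->|sn0] := eqVneq s 0; first by rewrite powRr0 addr0.
have [->|sn1] := eqVneq s 1; first by rewrite powRr1.
have s0' : 0 < s by rewrite lt_neqAle eq_sym sn0.
have s1' : 0 < 1 - s by rewrite subr_gt0 lt_neqAle sn1.
have := @conjugate_powR R (2 `^ s) 1 s^-1 (1 - s)^-1.
rewrite powR_ge0 !invr_gt0 !invrK -powRrM divff// powRr1// powR1.
move=> /(_ isT ler01 s0' s1'); lra.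
Qed.

End powR_inequalities.

(** * The trigonometric inequality behind the norm of the Hilbert transform *)

Section exponent_le2.
Variable R : realType.
Implicit Types (a C t x y : R).

Lemma cos_nincr x y : 0 <= x -> x <= y -> y <= pi -> cos y <= cos x.
Proof.
move=> x0; rewrite le_eqVlt => /predU1P[->//|xy] ypi; apply: ltW.
by rewrite ltr_cos// in_itv/=; apply/andP; split; lra.
Qed.

(** The left side is the tangent line at [pi / 4]; the difference of the two sides has derivative
    tan^2 - 1, nonnegative past that point. *)
Lemma tan_ge_piquarter x : pi / 4 <= x < pi / 2 -> 1 + 2 * (x - pi / 4) <= tan x.
Proof.
move=> /andP[xpi4 xpi2]; have pi0 := pi_gt0 R.
have c0 y : pi / 4 <= y <= x -> 0 < cos y.
  by move=> /andP[y1 y2]; apply: cos_gt0_pihalf; apply/andP; split; lra.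
suff : tan (pi / 4) - 2 * (pi / 4) <= tan x - 2 * x by rewrite tan_piquarter; lra.
apply: (@derive_ge0_le _ (fun y : R => tan y - 2 * y) (fun y => (cos y)^-2 - 2) _ _ xpi4) => y yx.
  have h1 := is_derive_tan (lt0r_neq0 (c0 _ yx)).
  have h2 : is_derive y 1 (fun t : R => 2 * t) (2 *: 1) by apply: is_deriveZ.
  by apply: is_derive_eq; rewrite -![_ *: _]/(_ * _) mulr1.
have tge1 : 1 <= tan y.
  rewrite -tan_piquarter; move: (yx) => /andP[y1 y2].
  move: y1; rewrite le_eqVlt => /predU1P[->//|y1]; apply: ltW.
  by rewrite ltr_tan// in_itv/=; apply/andP; split; lra.
by rewrite cos2_tan2 ?gt_eqF ?c0//; nra.
Qed.

(** The chain is 2^(1 - a) <= 2 - a <= tan (pi / (4 a)) <= tan (pi / (4 a))^(2 a): [powR2_le], the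
    tangent line with pi >= 2, and a base at least 1 raised to a power at least 1. It lets the
    Hilbert constant absorb the loss in [powR_add_le]. *)
Lemma tan_powR_ge a : 2^-1 < a <= 1 ->
  2 `^ (1 - a) <= tan (pi / (4 * a)) `^ (2 * a).
Proof.
move=> /andP[a0 a1]; have pi2 := pi_ge2 R.
have a4 : 0 < 4 * a by lra.
have tge : 1 + 2 * (pi / (4 * a) - pi / 4) <= tan (pi / (4 * a)).
  apply: tan_ge_piquarter; apply/andP; split.
    by rewrite ler_pM2l ?pi_gt0// lef_pV2 ?posrE//; lra.
  by rewrite ltr_pM2l ?pi_gt0// ltf_pV2 ?posrE//; lra.
have tge2 : 1 + (1 - a) <= tan (pi / (4 * a)).
  apply: le_trans tge; rewrite lerD2l.
  have -> : 2 * (pi / (4 * a) - pi / 4) = pi / 2 * ((1 - a) / a) by field; lra.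
  apply: (@le_trans _ _ ((1 - a) / a)).
    by rewrite ler_pdivlMr; nra.
  by rewrite ler_peMl// ?divr_ge0//; lra.
apply: le_trans (le_trans (powR2_le _) tge2) _.
  by apply/andP; split; lra.
by apply: le1r_powR; lra.
Qed.

(** In both cases cos (a t) is at least |cos t|^a with the sign of cos t. Subadditivity then settles
    cos t > 0, and midpoint concavity the rest. *)
Lemma hilbert_inequality_le2 a C t : 2^-1 < a <= 1 -> 1 <= C -> 0 <= t <= pi ->
  (C + cos t) `^ a <=
  tan (pi / (4 * a)) `^ (2 * a) * (C - cos t) `^ a + 2 `^ a * cos (a * t).
Proof.
move=> ha C1 /andP[t0 tpi]; have /andP[a0 a1] := ha.
have hT := tan_powR_ge ha.
set T := tan _ `^ _ in hT *.
have pi0 := pi_gt0 R.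
have T1 : 1 <= T by apply: le_trans hT; rewrite -[leLHS](@powRr0 _ 2) ler_powR// ; lra.
have cN1 := cos_geN1 t; have c1 := cos_le1 t.
have a01 : 0 <= a <= 1 by apply/andP; split; lra.
have [tpi2|tpi2] := leP (pi / 2) t; last first.
  have c0 : 0 < cos t by apply: cos_gt0_pihalf; apply/andP; split; lra.
  have hc : cos t `^ a <= cos (a * t).
    have := @cos_ratio_ndecr R a 0 t (lexx _) t0 tpi2 _ a1.
    by rewrite mulr0 cos0 powR1 mul1r mulr1; apply; lra.
  have := @powR_subadd _ a (C - cos t) (2 * cos t) a01.
  rewrite (_ : _ - _ + _ = C + cos t); last by ring.
  move=> /(_ _ _)/le_trans; apply; [lra|lra|].
  apply: lerD; first by rewrite ler_peMl ?powR_ge0.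
  rewrite powRM ?(ltW c0)//.
  by rewrite ler_wpM2l ?powR_ge0.
(* After reflection the claim reads (C - cos s)^a + (2 cos s)^a <= T (C + cos s)^a, up to the bound
   on - cos (a t). *)
pose s := pi - t.
have ts : t = pi - s by rewrite /s; ring.
have cts : cos t = - cos s by rewrite ts cosB cospi sinpi; ring.
have s0 : 0 <= s by rewrite /s; lra.
have spi2 : s <= pi / 2 by rewrite /s; lra.
have cs0 : 0 <= cos s by apply: cos_ge0_pihalf; apply/andP; split; lra.
have hc : - cos (a * t) <= cos s `^ a.
  have -> : - cos (a * t) = cos (pi - a * t) by rewrite cosB cospi sinpi; ring.
  apply: (@le_trans _ _ (cos s)).
    by apply: cos_nincr; rewrite ?s0//=; rewrite /s; nra.
  move: cs0; rewrite le0r => /predU1P[->|cs0]; first exact: powR_ge0.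
  by rewrite ger1_powR// cs0 cos_le1.
have := @powR_add_le _ a (C - cos s) (2 * cos s).
rewrite (_ : _ - _ + _ = C + cos s); last by ring.
rewrite a1 (lt_trans _ a0)// => /(_ isT) h.
have {}h : (C - cos s) `^ a + (2 * cos s) `^ a <= T * (C + cos s) `^ a.
  have Cs : 0 <= C - cos s by have := cos_le1 s; lra.
  apply: le_trans (h Cs _) _; first by rewrite mulr_ge0.
  by rewrite ler_wpM2r ?powR_ge0.
rewrite cts opprK; apply: le_trans (_ : T * (C + cos s) `^ a - (2 * cos s) `^ a <= _).
  by lra.
rewrite lerD2l powRM// -mulrN ler_wpM2l ?powR_ge0//; lra.
Qed.

End exponent_le2.

(** Pichorides' inequality, divided by (sin x)^p, asks for a lower bound of this quotient. The
    cosine of a difference and sin^2 + cos^2 = 1 reduce the last factor of the derivative to two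
    cosine terms. *)
Lemma is_derive_pichorides (R : realType) (p B x : R) :
  0 < cos x -> 0 < sin x ->
  is_derive x 1 (fun x => (B * cos (p * x) - cos x `^ p) * sin x `^ (- p))
   (p * sin x `^ (- p - 1) * (cos x `^ (p - 1) - B * cos ((p - 1) * x))).
Proof.
move=> cx sx.
have h1 : is_derive x 1 (fun t : R => p * t) (p *: 1) by apply: is_deriveZ.
have h2 : is_derive x 1 (fun t => cos (p * t)) (- sin (p * x) * p).
  apply: is_derive_eq (@is_derive1_comp _ (@cos R) (fun t : R => p * t) x _ _ (is_derive_cos _) h1) _.
  by rewrite scaler1.
have h2' : is_derive x 1 (fun t => B * cos (p * t)) (B *: (- sin (p * x) * p)).
  exact: is_deriveZ.
have h3 : is_derive x 1 (fun t => cos t `^ p) (p * cos x `^ (p - 1) * (- sin x)).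
  exact: (@is_derive1_comp _ (fun y : R => y `^ p) (@cos R) x _ _ (is_derive1_powR _ cx) (is_derive_cos _)).
have h4 : is_derive x 1 (fun t => sin t `^ (- p)) (- p * sin x `^ (- p - 1) * cos x).
  exact: (@is_derive1_comp _ (fun y : R => y `^ (- p)) (@sin R) x _ _ (is_derive1_powR _ sx) (is_derive_sin _)).
have h5 := is_deriveB h2' h3.
apply: is_derive_eq (is_deriveM h5 h4) _.
have e1 : sin x `^ (- p) = sin x * sin x `^ (- p - 1).
  rewrite -[X in X * _]powRr1 ?ltW// -powRD.
    by congr (_ `^ _); ring.
  by rewrite (gt_eqF sx) implybT.
have e2 : cos x `^ p = cos x * cos x `^ (p - 1).
  rewrite -[X in X * _]powRr1 ?ltW// -powRD.
    by congr (_ `^ _); ring.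
  by rewrite (gt_eqF cx) implybT.
change ((B * cos (p * x) - cos x `^ p) * (- p * sin x `^ (- p - 1) * cos x) +
  sin x `^ (- p) * (B * (- sin (p * x) * p) - p * cos x `^ (p - 1) * - sin x) =
  p * sin x `^ (- p - 1) * (cos x `^ (p - 1) - B * cos ((p - 1) * x))).
have -> : (p - 1) * x = p * x - x by ring.
rewrite cosB e1 e2.
set S := sin x `^ _; set C := cos x `^ _.
have e3 : sin x ^+ 2 = 1 - cos x ^+ 2 by rewrite sin2cos2.
have {}e3 : C = C * cos x ^+ 2 + C * sin x ^+ 2 by rewrite e3; ring.
rewrite [X in _ = p * S * (X - _)]e3; ring.
Qed.

(* After division by [sin x `^ p] the derivative of the difference has the sign
   of [cos x `^ (p - 1) - B * cos ((p - 1) * x)], which by the monotonicity of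
   [cos (a * x) / cos x `^ a] changes only at [s0], where equality holds. *)
Lemma pichorides_inequality (R : realType) (p s0 x : R) :
  2 < p -> p * (2 * s0) = pi -> 0 <= x <= pi / 2 ->
  cos x `^ p <=
  cot s0 `^ p * sin x `^ p + cos s0 `^ (p - 1) / sin s0 * cos (p * x).
Proof.
move=> p2 ps0 /andP[x0 xpi2]; have pi0 := pi_gt0 R.
have s0_gt0 : 0 < s0.
  have p0 : 0 < p * 2 by lra.
  by rewrite -(pmulr_rgt0 _ p0) -mulrA ps0.
have s0_lt : s0 < pi / 4.
  have : 0 < (p - 2) * s0 by rewrite mulr_gt0// subr_gt0.
  by lra.
have cs0 : 0 < cos s0 by apply: cos_gt0_pihalf; apply/andP; split; lra.
have ss0 : 0 < sin s0 by apply: sin_gt0_pi; apply/andP; split; lra.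
set B := cos s0 `^ (p - 1) / sin s0.
have B_ge0 : 0 <= B by rewrite divr_ge0 ?powR_ge0 ?ltW.
(* By [ps0] the angle [(p - 1) * s0] is [pi / 2 - s0]; hence [B] is the value for which the
   derivative of the quotient vanishes at [s0]. *)
have cosp1 : cos ((p - 1) * s0) = sin s0.
  by rewrite -cosBpihalf -cosN; congr cos; lra.
have B_cos_ge (y : R) : 0 <= y -> y <= s0 -> cos y `^ (p - 1) <= B * cos ((p - 1) * y).
  move=> y0 ys; have := @cos_ratio_nincr R (p - 1) y s0 y0 ys.
  rewrite cosp1 mulrAC ler_pdivlMr// => h.
  rewrite [leLHS]mulrC [leRHS]mulrC; apply: h; [lra|lra|].
  have : 0 < (p - 2) * s0 by rewrite mulr_gt0// subr_gt0.
  by lra.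
have B_cos_le (y : R) : s0 <= y -> y <= 2 * s0 -> B * cos ((p - 1) * y) <= cos y `^ (p - 1).
  move=> sy ys; have := @cos_ratio_nincr R (p - 1) s0 y (ltW s0_gt0) sy.
  rewrite cosp1 mulrAC ler_pdivrMr// => h.
  rewrite [leLHS]mulrC [leRHS]mulrC; apply: h; [lra|lra|].
  by apply: (@le_trans _ _ ((p - 2) * (2 * s0))); [rewrite -addrA -opprD ler_wpM2l; lra|lra].
pose f y := (B * cos (p * y) - cos y `^ p) * sin y `^ (- p).
pose df y := p * sin y `^ (- p - 1) * (cos y `^ (p - 1) - B * cos ((p - 1) * y)).
have is_derive_f y : 0 < cos y -> 0 < sin y -> is_derive y 1 f (df y).
  by move=> cy sy; exact: is_derive_pichorides.
have cotE : cot s0 `^ p = cos s0 `^ p * sin s0 `^ (- p).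
  by rewrite /cot powRM ?invr_ge0 ?ltW// -[(sin s0)^-1]powR_inv1 ?ltW// -powRrM mulN1r.
have small (y : R) : 0 < y -> y <= 2 * s0 ->
    cos y `^ p <= cot s0 `^ p * sin y `^ p + B * cos (p * y).
  move=> y0 ys0.
  have sgt0 z : 0 < z -> z <= 2 * s0 -> 0 < sin z.
    by move=> z0 zs; apply: sin_gt0_pi; apply/andP; split; lra.
  have cgt0 z : 0 < z -> z <= 2 * s0 -> 0 < cos z.
    by move=> z0 zs; apply: cos_gt0_pihalf; apply/andP; split; lra.
  have fs0 : f s0 = - cot s0 `^ p.
    rewrite /f (_ : p * s0 = pi / 2) ?cos_pihalf; last by lra.
    by rewrite mulr0 sub0r mulNr cotE.
  suff : - cot s0 `^ p <= f y.
    have syp : 0 < sin y `^ p by rewrite powR_gt0// sgt0.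
    by rewrite /f powRN ler_pdivlMr//; lra.
  rewrite -fs0; have [ys|sy] := leP y s0.
    apply: (@derive_le0_ge _ f df); first exact: ys.
      move=> z /andP[yz zs].
      by apply: is_derive_f; [apply: cgt0|apply: sgt0]; lra.
    move=> z /andP[yz zs].
    rewrite /df mulr_ge0_le0// ?mulr_ge0 ?powR_ge0//; first by lra.
    by rewrite subr_le0 B_cos_ge//; lra.
  apply: (@derive_ge0_le _ f df); first exact: ltW.
    move=> z /andP[yz zs].
    by apply: is_derive_f; [apply: cgt0|apply: sgt0]; lra.
  move=> z /andP[yz zs].
  rewrite /df !mulr_ge0 ?powR_ge0//; first by lra.
  by rewrite subr_ge0 B_cos_le//; lra.
have [xs0|s0x] := leP x (2 * s0).
  move: x0; rewrite le0r => /predU1P[->|x0]; last exact: small.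
  rewrite mulr0 !cos0 sin0 powR1 powR0 ?mulr0 ?add0r; last by lra.
  have := B_cos_ge 0 (lexx 0) (ltW s0_gt0).
  by rewrite mulr0 cos0 powR1.
have p0 : 0 <= p by lra.
(* Past [2 * s0] the value at that point suffices: the cosine has decreased, the sine has increased,
   and [cos (p * x)] is at least -1, its value at [2 * s0]. *)
have := small (2 * s0) _ (lexx _).
rewrite ps0 cospi => /(_ _) h.
have {}h : cos (2 * s0) `^ p <= cot s0 `^ p * sin (2 * s0) `^ p - B.
  by have := h _; lra.
have hc : cos x `^ p <= cos (2 * s0) `^ p.
  apply: ge0_ler_powR => //; rewrite ?nnegrE.
  - by apply: cos_ge0_pihalf; apply/andP; split; lra.
  - by apply: cos_ge0_pihalf; apply/andP; split; lra.
  - by apply: cos_nincr; lra.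
have hs : sin (2 * s0) `^ p <= sin x `^ p.
  apply: ge0_ler_powR => //; rewrite ?nnegrE.
  - by apply: sin_ge0_pi; apply/andP; split; lra.
  - by apply: sin_ge0_pi; apply/andP; split; lra.
  - by rewrite -!cosBpihalf -[leLHS]cosN -[leRHS]cosN; apply: cos_nincr; lra.
have hh : cot s0 `^ p * sin (2 * s0) `^ p <= cot s0 `^ p * sin x `^ p.
  by rewrite ler_wpM2l ?powR_ge0.
have hB : - B <= B * cos (p * x).
  by rewrite -mulrN1 ler_wpM2l// cos_geN1.
lra.
Qed.

(** Both [u + d] and [v] lie between [u] and [v + d], with complementary weights, and the two
    convexity bounds add up: the increment of the power over a step [d] grows with the base
    point. *)
Lemma powR_shift_le (R : realType) (a u v d : R) :
  1 <= a -> 0 <= u -> u <= v -> 0 <= d ->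
  (u + d) `^ a + v `^ a <= (v + d) `^ a + u `^ a.
Proof.
move=> a1 u0 uv d0.
have [L0|L0] := eqVneq (v + d - u) 0.
  have -> : d = 0 by lra.
  by have -> : v = u by lra.
have Lp : 0 < v + d - u by lra.
have w01 : 0 <= d / (v + d - u) <= 1.
  by rewrite divr_ge0 ?(ltW Lp)//= ler_pdivrMr// mul1r; lra.
have w01' : 0 <= 1 - d / (v + d - u) <= 1 by move: w01 => /andP[]; lra.
have vd0 : 0 <= v + d by lra.
have h1 := powR_conv_le a1 w01 vd0 u0.
have h2 := powR_conv_le a1 w01' vd0 u0.
rewrite (_ : _ * _ + _ = u + d) in h1; last by field.
rewrite (_ : _ * _ + _ = v) in h2; last by field.
lra.
Qed.

Section half_angle.
Variable R : realType.
Implicit Types a e : R.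

Lemma oneD_cos e : 1 + cos e = 2 * cos (e / 2) ^+ 2.
Proof.
have {1}-> : e = (e / 2) *+ 2 by rewrite mulr2n -splitr.
by rewrite cos_mulr2n -mulr_natl; ring.
Qed.

Lemma oneB_cos e : 1 - cos e = 2 * sin (e / 2) ^+ 2.
Proof.
have {1}-> : e = (e / 2) *+ 2 by rewrite mulr2n -splitr.
by rewrite cos_mulr2n -mulr_natl sin2cos2; ring.
Qed.

Lemma powR_sqr (x a : R) : 0 <= x -> (x ^+ 2) `^ a = x `^ (2 * a).
Proof. by move=> x0; rewrite powRrM powR_mulrn. Qed.

End half_angle.

(* For [t >= 2 * s0] the left side minus the right side decreases with [C], and
   [C = 1] is Pichorides' inequality at [t / 2]; for smaller [t], writing
   [cos t = C * cos e] reduces to Pichorides' inequality at [e / 2]. *)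
Lemma hilbert_inequality_gt2 (R : realType) (a s0 C t : R) :
  1 < a -> 4 * a * s0 = pi -> 1 <= C -> 0 <= t <= pi ->
  (C + cos t) `^ a <= cot s0 `^ (2 * a) * (C - cos t) `^ a +
    2 `^ a * (cos s0 `^ (2 * a - 1) / sin s0) * cos (a * t).
Proof.
move=> a1 as0 C1 /andP[t0 tpi]; have pi0 := pi_gt0 R.
have s0_gt0 : 0 < s0.
  have p0 : 0 < 4 * a by lra.
  by rewrite -(pmulr_rgt0 _ p0) as0.
have s0_lt : s0 < pi / 4.
  have : 0 < (a - 1) * s0 by rewrite mulr_gt0// subr_gt0.
  by lra.
have cs0 : 0 < cos s0 by apply: cos_gt0_pihalf; apply/andP; split; lra.
have ss0 : 0 < sin s0 by apply: sin_gt0_pi; apply/andP; split; lra.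
set B := _ / sin s0.
have B_ge0 : 0 <= B by rewrite divr_ge0 ?powR_ge0 ?ltW.
set h := cot s0.
have h_ge0 : 0 <= h by rewrite divr_ge0 ?ltW.
have h_ge1 : 1 <= h.
  rewrite /h /cot ler_pdivlMr// mul1r -cosBpihalf -cosN.
  by apply: cos_nincr; lra.
have hsqr : h `^ (2 * a) = (h ^+ 2) `^ a by rewrite powR_sqr.
have pich (e : R) : 0 <= e <= pi -> (1 + cos e) `^ a <=
    h `^ (2 * a) * (1 - cos e) `^ a + 2 `^ a * B * cos (a * e).
  move=> /andP[e0 epi].
  have ch : 0 <= cos (e / 2) by apply: cos_ge0_pihalf; apply/andP; split; lra.
  have sh : 0 <= sin (e / 2) by apply: sin_ge0_pi; apply/andP; split; lra.
  rewrite oneD_cos powRM ?sqr_ge0// powR_sqr// oneB_cos powRM ?sqr_ge0// powR_sqr//.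
  have := @pichorides_inequality R (2 * a) s0 (e / 2).
  have -> : 2 * a * (e / 2) = a * e by field.
  move=> hp; rewrite mulrCA -mulrA -mulrDr ler_wpM2l ?powR_ge0// hp; lra.
have cot_le (e : R) : 2 * s0 <= e <= pi -> 1 + cos e <= h ^+ 2 * (1 - cos e).
  move=> /andP[se epi]; rewrite oneD_cos oneB_cos [leRHS]mulrCA ler_wpM2l// -(exprMn 2).
  have ch : 0 <= cos (e / 2) by apply: cos_ge0_pihalf; apply/andP; split; lra.
  have sh : 0 <= sin (e / 2) by apply: sin_ge0_pi; apply/andP; split; lra.
  apply: lerXn2r; rewrite ?nnegrE ?(mulr_ge0 h_ge0)//.
  rewrite /h /cot mulrAC ler_pdivlMr//.
  have : 0 <= sin (e / 2 - s0) by apply: sin_ge0_pi; apply/andP; split; lra.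
  by rewrite sinB; lra.
move: {cs0 ss0} B B_ge0 h h_ge0 h_ge1 hsqr pich cot_le => B B_ge0 h h_ge0 h_ge1 hsqr pich cot_le.
have cN1 := cos_geN1 t; have c1 := cos_le1 t.
have [ts|ts] := leP (2 * s0) t.
  have := pich t; rewrite t0 tpi => /(_ isT).
  have := cot_le t; rewrite ts tpi => /(_ isT) hc.
  rewrite hsqr -!powRM ?sqr_ge0//; try lra.
  move=> hp.
  have h2 : 1 <= h ^+ 2 by rewrite expr_ge1.
  (* The step is the gap at C = 1, nonnegative by [cot_le]. Passing to C raises both bases by C - 1,
     and [h ^+ 2 >= 1] leaves room on the right. *)
  have := @powR_shift_le R a (1 + cos t) (C + cos t) (h ^+ 2 * (1 - cos t) - (1 + cos t)).
  move=> /(_ (ltW a1)) hs.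
  have {}hs : (h ^+ 2 * (1 - cos t)) `^ a + (C + cos t) `^ a <=
      (C + cos t + (h ^+ 2 * (1 - cos t) - (1 + cos t))) `^ a + (1 + cos t) `^ a.
    apply: le_trans (hs _ _ _); try lra.
    by rewrite (_ : 1 + cos t + _ = h ^+ 2 * (1 - cos t))//; ring.
  have : (C + cos t + (h ^+ 2 * (1 - cos t) - (1 + cos t))) `^ a <= (h ^+ 2 * (C - cos t)) `^ a.
    have : 0 <= (h ^+ 2 - 1) * (C - 1) by rewrite mulr_ge0 ?subr_ge0.
    move=> ?; apply: ge0_ler_powR; rewrite ?nnegrE; try lra.
  by lra.
have ct0 : 0 < cos t by apply: cos_gt0_pihalf; apply/andP; split; lra.
have C0 : 0 < C by lra.
have cC1 : cos t / C <= 1 by rewrite ler_pdivrMr ?mul1r; lra.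
have cC0 : 0 < cos t / C by rewrite divr_gt0.
have cCN1 : -1 <= cos t / C by lra.
pose e := acos (cos t / C).
have ce : cos e = cos t / C by rewrite acosK// in_itv/= cCN1 cC1.
have e0 : 0 <= e by rewrite acos_ge0// cCN1 cC1.
have epi : e <= pi by rewrite acos_lepi// cCN1 cC1.
have te : t <= e.
  rewrite leNgt; apply/negP => et.
  have : cos t < cos e by rewrite ltr_cos// in_itv/=; apply/andP; split; lra.
  by rewrite ce ltNge => /negP; apply; rewrite ler_pdivrMr//; nra.
have cte : cos t = C * cos e by rewrite ce mulrC divfK ?gt_eqF.
have cat : 0 <= cos (a * t).
  apply: cos_ge0_pihalf; have : a * t <= a * (2 * s0) by rewrite ler_wpM2l; lra.
  have : 0 <= a * t by rewrite mulr_ge0; lra.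
  by move=> ? ?; apply/andP; split; lra.
have eq1 : C + cos t = C * (1 + cos e) by rewrite cte; ring.
have eq2 : C - cos t = C * (1 - cos e) by rewrite cte; ring.
have ce1 := cos_le1 e; have ceN1 := cos_geN1 e.
(* Since [a * t <= pi / 2], the cosine term is nonnegative; for [e] past [2 * s0] the first term on
   the right is already enough. *)
have [es|es] := leP (2 * s0) e.
  apply: (@le_trans _ _ (h `^ (2 * a) * (C - cos t) `^ a)); last first.
    by rewrite lerDl !mulr_ge0 ?powR_ge0.
  rewrite hsqr -powRM ?sqr_ge0//; last by lra.
  have hce : 1 + cos e <= h ^+ 2 * (1 - cos e) by apply: cot_le; rewrite es.
  apply: ge0_ler_powR; rewrite ?nnegrE ?mulr_ge0 ?sqr_ge0//; try lra.
  by rewrite eq1 eq2 mulrCA ler_wpM2l// ltW.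
have hp : (1 + cos e) `^ a <= h `^ (2 * a) * (1 - cos e) `^ a + 2 `^ a * B * cos (a * e).
  by apply: pich; rewrite e0.
(* The ratio of cos (a x) to (cos x)^a does not increase from [t] to [e], and cos t / cos e = C: the
   cosine term at [e] becomes the one at [t]. *)
have hr : cos (a * e) * cos t `^ a <= cos (a * t) * cos e `^ a.
  apply: cos_ratio_nincr => //; try lra.
  have : (a - 1) * e <= (a - 1) * (2 * s0) by rewrite ler_wpM2l; lra.
  by lra.
have hr2 : C `^ a * cos (a * e) <= cos (a * t).
  have ce_gt0 : 0 < cos e by rewrite ce.
  move: hr; rewrite cte (powRM _ (ltW C0) (ltW ce_gt0)).
  by rewrite mulrA ler_pM2r ?powR_gt0// [leLHS]mulrC.
rewrite eq1 eq2 !powRM; try lra.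
rewrite mulrCA; apply: le_trans (_ : C `^ a * (h `^ (2 * a) * (1 - cos e) `^ a +
   2 `^ a * B * cos (a * e)) <= _); first by rewrite ler_wpM2l ?powR_ge0.
rewrite mulrDr lerD2l mulrCA ler_wpM2l ?mulr_ge0 ?powR_ge0//.
Qed.

(** The coefficient [b] depends on [p] alone: on the line C and t vary with the point, while the
    term with [b] has to integrate to 0. Negative t are covered because the cosine is even. *)
Lemma hilbert_const_inequality (R : realType) (p : R) : 1 < p ->
  exists2 b, 0 <= b & forall C t : R, 1 <= C -> `|t| <= pi ->
  (C + cos t) `^ (p / 2) <=
  hilbert_const p `^ p * (C - cos t) `^ (p / 2) + b * cos (p / 2 * t).
Proof.
move=> p1; rewrite /hilbert_const.
have pE : p = 2 * (p / 2) by field.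
have cos_norm (x : R) : cos x = cos `|x| by case: (ger0P x) => // _; rewrite cosN.
have p2_ge0 : 0 <= p / 2 by lra.
suff [b b0 hb] : exists2 b, 0 <= b & forall C t : R, 1 <= C -> 0 <= t <= pi ->
  (C + cos t) `^ (p / 2) <=
  (if p <= 2 then tan (pi / (2 * p)) else cot (pi / (2 * p))) `^ p *
   (C - cos t) `^ (p / 2) + b * cos (p / 2 * t).
  exists b => // C t C1 tpi.
  rewrite (cos_norm t) (cos_norm (p / 2 * t)) normrM (ger0_norm p2_ge0).
  by apply: hb => //; rewrite normr_ge0.
case: leP => [p2|p2].
  exists (2 `^ (p / 2)); first exact: powR_ge0.
  move=> C t C1 tpi.
  have := @hilbert_inequality_le2 R (p / 2) C t _ C1 tpi.
  rewrite -pE (_ : 4 * (p / 2) = 2 * p); last by field.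
  by apply; lra.
set s0 := pi / (2 * p).
have pi0 := pi_gt0 R.
have s0_gt0 : 0 < s0 by rewrite divr_gt0//; lra.
have s0_lt : s0 < pi / 4 by rewrite ltr_pM2l// ltf_pV2 ?posrE; lra.
exists (2 `^ (p / 2) * (cos s0 `^ (2 * (p / 2) - 1) / sin s0)).
  rewrite mulr_ge0 ?powR_ge0// divr_ge0 ?powR_ge0// sin_ge0_pi//.
  by apply/andP; split; lra.
move=> C t C1 tpi.
have := @hilbert_inequality_gt2 R (p / 2) s0 C t _ _ C1 tpi.
rewrite -pE; apply; first by lra.
by rewrite /s0; field; lra.
Qed.

Lemma hilbert_const_gt0 (R : realType) (p : R) : 1 < p -> 0 < hilbert_const p.
Proof.
move=> p1; rewrite /hilbert_const; have pi0 := pi_gt0 R.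
have s0_gt0 : 0 < pi / (2 * p) by rewrite divr_gt0//; lra.
have s0_lt : pi / (2 * p) < pi / 2 by rewrite ltr_pM2l// ltf_pV2 ?posrE; lra.
have cs0 : 0 < cos (pi / (2 * p)) by apply: cos_gt0_pihalf; apply/andP; split; lra.
have ss0 : 0 < sin (pi / (2 * p)) by apply: sin_gt0_pi; apply/andP; split; lra.
by case: ifP => _; rewrite divr_gt0.
Qed.

(** * Complex-valued functions of a real variable *)

Section complex_calculus.
Local Open Scope complex_scope.
Variable R : realType.
Implicit Types (x y t : R) (w : R[i]).

Local Notation Re := complex.Re.
Local Notation Im := complex.Im.

Lemma cReD w1 w2 : Re (w1 + w2) = Re w1 + Re w2.
Proof. by case: w1 w2 => [a b] [c d]. Qed.
Lemma cImD w1 w2 : Im (w1 + w2) = Im w1 + Im w2.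
Proof. by case: w1 w2 => [a b] [c d]. Qed.
Lemma cReM w1 w2 : Re (w1 * w2) = Re w1 * Re w2 - Im w1 * Im w2.
Proof. by case: w1 w2 => [a b] [c d]. Qed.
Lemma cImM w1 w2 : Im (w1 * w2) = Re w1 * Im w2 + Im w1 * Re w2.
Proof. by case: w1 w2 => [a b] [c d]. Qed.
Lemma cReV w : Re w^-1 = Re w / (Re w ^+ 2 + Im w ^+ 2).
Proof. by case: w => [a b]. Qed.
Lemma cImV w : Im w^-1 = - (Im w / (Re w ^+ 2 + Im w ^+ 2)).
Proof. by case: w => [a b]. Qed.

Lemma sqr_normcE w : normc w ^+ 2 = Re w ^+ 2 + Im w ^+ 2.
Proof. by case: w => [a b]; rewrite /normc sqr_sqrtr ?addr_ge0 ?sqr_ge0. Qed.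
Lemma normc_ge0 w : 0 <= normc w.
Proof. by case: w => [a b]; exact: sqrtr_ge0. Qed.
Lemma Re2Im2_gt0 w : w != 0 -> 0 < Re w ^+ 2 + Im w ^+ 2.
Proof.
case: w => [a b]; rewrite eq_complex /= negb_and => ab.
rewrite lt0r addr_ge0 ?sqr_ge0// andbT paddr_eq0 ?sqr_ge0// !sqrf_eq0.
by rewrite negb_and.
Qed.
Lemma normc_gt0 w : w != 0 -> 0 < normc w.
Proof.
by move=> /Re2Im2_gt0; rewrite -sqr_normcE exprn_even_gt0//= lt0r normc_ge0 andbT.
Qed.

(** A complex function of a real variable is handled through its two real components. Holomorphy
    then becomes a pair of such derivatives, in [x] and in the depth, related by the factor - i. *)
Definition is_cderive (f : R -> R[i]) t (df : R[i]) :=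
  is_derive t 1 (fun s => Re (f s)) (Re df) /\
  is_derive t 1 (fun s => Im (f s)) (Im df).

Definition ccontinuous_at (f : R -> R[i]) t :=
  continuous_at t (fun s => Re (f s)) /\ continuous_at t (fun s => Im (f s)).

Lemma is_cderive_eq f t df df' : is_cderive f t df -> df = df' ->
  is_cderive f t df'.
Proof. by move=> ? <-. Qed.

Lemma cderive_continuous f t df : is_cderive f t df -> ccontinuous_at f t.
Proof.
by move=> [[h1 _] [h2 _]]; split; apply: differentiable_continuous;
  exact/derivable1_diffP.
Qed.

Lemma cderive_cst w t : is_cderive (fun=> w) t 0.
Proof. by split; exact: is_derive_cst. Qed.

Lemma cderiveD f g t df dg : is_cderive f t df -> is_cderive g t dg ->
  is_cderive (fun s => f s + g s) t (df + dg).
Proof.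
move=> [f1 f2] [g1 g2]; split.
  by rewrite cReD; under eq_fun do rewrite cReD; exact: is_deriveD.
by rewrite cImD; under eq_fun do rewrite cImD; exact: is_deriveD.
Qed.

Lemma cderiveM f g t df dg : is_cderive f t df -> is_cderive g t dg ->
  is_cderive (fun s => f s * g s) t (df * g t + f t * dg).
Proof.
move=> [f1 f2] [g1 g2]; split.
  under eq_fun do rewrite cReM.
  apply: is_derive_eq (is_deriveB (is_deriveM f1 g1) (is_deriveM f2 g2)) _.
  by rewrite -![_ *: _]/(_ * _) cReD !cReM; ring.
under eq_fun do rewrite cImM.
apply: is_derive_eq (is_deriveD (is_deriveM f1 g2) (is_deriveM f2 g1)) _.
by rewrite -![_ *: _]/(_ * _) cImD !cImM; ring.
Qed.

Lemma cderiveV f t df : f t != 0 -> is_cderive f t df ->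
  is_cderive (fun s => (f s)^-1) t (- df / f t ^+ 2).
Proof.
move=> f0 [f1 f2].
have n0 := Re2Im2_gt0 f0.
have hn : is_derive t 1 (fun s => Re (f s) ^+ 2 + Im (f s) ^+ 2)
    (2 * (Re (f t) * Re df + Im (f t) * Im df)).
  under eq_fun do rewrite !expr2.
  apply: is_derive_eq (is_deriveD (is_deriveM f1 f1) (is_deriveM f2 f2)) _.
  by rewrite -![_ *: _]/(_ * _); ring.
have hV := @is_deriveV _ (fun s => Re (f s) ^+ 2 + Im (f s) ^+ 2) t _ _ (lt0r_neq0 n0) hn.
have sqrE (a b : R) : (a * a - b * b) ^+ 2 + (a * b + b * a) ^+ 2 = (a ^+ 2 + b ^+ 2) ^+ 2.
  by ring.
split.
  under eq_fun do rewrite cReV.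
  apply: is_derive_eq (is_deriveM f1 hV) _.
  rewrite -![_ *: _]/(_ * _) cReM cReV cImV (expr2 (f t)) cReM cImM.
  case: (f t) (df) n0 => [a b] [c d] /= n0.
  by rewrite sqrE; field; rewrite gt_eqF.
under eq_fun do rewrite cImV.
apply: is_derive_eq (is_deriveN (is_deriveM f2 hV)) _.
rewrite -![_ *: _]/(_ * _) cImM cReV cImV (expr2 (f t)) cReM cImM.
case: (f t) (df) n0 => [a b] [c d] /= n0.
by rewrite sqrE; field; rewrite gt_eqF.
Qed.

Definition cexp w : R[i] := (expR (Re w) * cos (Im w)) +i* (expR (Re w) * sin (Im w)).

(** The principal logarithm on the right half-plane only, since elsewhere the arctangent of the
    slope is not the argument; the functions it is applied to below take their values there. *)
Definition clog w : R[i] := (ln (Re w ^+ 2 + Im w ^+ 2) / 2) +i* atan (Im w / Re w).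

Lemma cderive_exp f t df : is_cderive f t df ->
  is_cderive (fun s => cexp (f s)) t (df * cexp (f t)).
Proof.
move=> [f1 f2].
have e1 := @is_derive1_comp _ (@expR R) (fun s => Re (f s)) t _ _ (is_derive_expR _) f1.
have c2 := @is_derive1_comp _ (@cos R) (fun s => Im (f s)) t _ _ (is_derive_cos _) f2.
have s2 := @is_derive1_comp _ (@sin R) (fun s => Im (f s)) t _ _ (is_derive_sin _) f2.
split.
  apply: is_derive_eq (is_deriveM e1 c2) _.
  by rewrite -![_ *: _]/(_ * _) cReM /=; ring.
apply: is_derive_eq (is_deriveM e1 s2) _.
by rewrite -![_ *: _]/(_ * _) cImM /=; ring.
Qed.

Lemma cderive_log f t df : 0 < Re (f t) -> is_cderive f t df ->
  is_cderive (fun s => clog (f s)) t (df / f t).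
Proof.
move=> f0 [f1 f2].
have hn : is_derive t 1 (fun s => Re (f s) ^+ 2 + Im (f s) ^+ 2)
    (2 * (Re (f t) * Re df + Im (f t) * Im df)).
  under eq_fun do rewrite !expr2.
  apply: is_derive_eq (is_deriveD (is_deriveM f1 f1) (is_deriveM f2 f2)) _.
  by rewrite -![_ *: _]/(_ * _); ring.
have n0 : 0 < Re (f t) ^+ 2 + Im (f t) ^+ 2.
  by rewrite ltr_pwDl ?sqr_ge0// exprn_gt0.
have hV := @is_deriveV _ (fun s => Re (f s)) t _ _ (lt0r_neq0 f0) f1.
have hq := is_deriveM f2 hV.
split.
  have hl := @is_derive1_comp _ (@ln R) (fun s => Re (f s) ^+ 2 + Im (f s) ^+ 2) t _ _ (is_derive1_ln n0) hn.
  have hl2 := is_deriveM hl (is_derive_cst (2^-1 : R) t 1).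
  apply: is_derive_eq hl2 _.
  rewrite -![_ *: _]/(_ * _) cReM cReV cImV.
  case: (f t) (df) n0 => [a b] [c d] /= n0.
  by field; rewrite gt_eqF.
have ha := @is_derive1_comp _ (@atan R) (fun s => Im (f s) * (Re (f s))^-1) t _ _ (is_derive1_atan _) hq.
apply: is_derive_eq ha _.
rewrite -![_ *: _]/(_ * _) cImM cReV cImV.
case: (f t) (df) n0 f0 => [a b] [c d] /= n0 f0.
by field; rewrite !gt_eqF.
Qed.

End complex_calculus.

(** * Integrals over the real line *)

Section bracket.
Variable R : realType.
Implicit Types (x s c e : R).
Local Notation mu := (@lebesgue_measure R).

Lemma powRN_small s e : 0 < s -> 0 < e ->
  exists2 A, 0 < A & forall x, A <= x -> x `^ (- s) <= e.
Proof.
move=> s0 e0; exists (e `^ (- s^-1)); first exact: powR_gt0.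
move=> x Ax; have x0 : 0 < x by apply: lt_le_trans Ax; exact: powR_gt0.
have : (e `^ (- s^-1)) `^ s <= x `^ s.
  by apply: ge0_ler_powR; rewrite ?nnegrE ?powR_ge0 ?(ltW s0) ?(ltW x0).
rewrite -powRrM mulNr mulVf ?gt_eqF// !powRN powRr1 ?(ltW e0)// => h.
by rewrite -[leRHS]invrK lef_pV2// posrE ?invr_gt0// powR_gt0.
Qed.

Lemma bracket_small s e : 0 < s -> 0 < e ->
  exists2 A, 0 < A & forall x, A <= `|x| -> (1 + x ^+ 2) `^ (- s) <= e.
Proof.
move=> s0 e0; have [A A0 hA] := powRN_small s0 e0.
exists (1 + A) => [|x Ax]; first by rewrite addr_gt0.
apply: hA; rewrite -real_normK ?num_real//.
by move: (`|x|) Ax => y Ay; nra.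
Qed.

Lemma bracket_gt0 x : 0 < 1 + x ^+ 2.
Proof. by rewrite ltr_pwDl// sqr_ge0. Qed.

Lemma is_derive_onePx_powR (b x : R) : 0 < 1 + x ->
  is_derive x 1 (fun t => (1 + t) `^ b) (b * (1 + x) `^ (b - 1)).
Proof.
move=> x0.
have h1 : is_derive x 1 (fun t : R => 1 + t) 1.
  apply: is_derive_eq (is_deriveD (is_derive_cst (1 : R) x 1) (is_derive_id x 1)) _.
  by rewrite add0r.
apply: is_derive_eq (@is_derive1_comp _ (fun y : R => y `^ b) (fun t : R => 1 + t) x _ _ (is_derive1_powR _ x0) h1) _.
by rewrite mulr1.
Qed.

Lemma continuous_bracket s : continuous (fun x => (1 + x ^+ 2) `^ (- s)).
Proof.
move=> x; apply: differentiable_continuous; apply/derivable1_diffP.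
have h1 : is_derive x 1 (fun t : R => 1 + t ^+ 2) (x + x).
  under eq_fun do rewrite expr2.
  apply: is_derive_eq (is_deriveD (is_derive_cst (1 : R) x 1) (is_deriveM (is_derive_id x 1) (is_derive_id x 1))) _.
  by rewrite add0r -![_ *: _]/(_ * _) mulr1.
by have [] := @is_derive1_comp _ (fun y : R => y `^ (- s)) (fun t : R => 1 + t ^+ 2) x _ _ (is_derive1_powR _ (bracket_gt0 x)) h1.
Qed.

Lemma integral_onePx_lty s : 1 < s ->
  (\int[mu]_(x in `[0%R, +oo[) ((1 + x) `^ (- s))%:E < +oo)%E.
Proof.
move=> s1.
pose F x := - ((s - 1)^-1 * (1 + x) `^ (- (s - 1))).
have dF x : -1 < x -> is_derive x 1 F ((1 + x) `^ (- s)).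
  move=> x1; have x0 : 0 < 1 + x by lra.
  have h := is_deriveN (is_deriveZ (s - 1)^-1 (is_derive_onePx_powR (- (s - 1)) x0)).
  apply: is_derive_eq h _; rewrite -![_ *: _]/(_ * _).
  rewrite (_ : - (s - 1) - 1 = - s); last by ring.
  by field; lra.
have cF x : -1 < x -> {for x, continuous F}.
  by move=> /dF[h _]; apply: differentiable_continuous; exact/derivable1_diffP.
rewrite (@ge0_continuous_FTC2y _ (fun x => (1 + x) `^ (- s)) F 0 0) ?ltry//.
- by move=> x _; rewrite powR_ge0.
- apply: continuous_in_subspaceT => x; rewrite inE/= in_itv/= andbT => x0.
  have x1 : 0 < 1 + x by lra.
  have [h _] := is_derive_onePx_powR (- s) x1.
  by apply: differentiable_continuous; exact/derivable1_diffP.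
- apply/cvgrPdist_le => e e0.
  have s1' : 0 < s - 1 by lra.
  have [A A0 hA] := powRN_small s1' (mulr_gt0 s1' e0).
  near=> x.
  have Ax : A <= 1 + x.
    by rewrite (@le_trans _ _ x) ?lerDr//; near: x; apply: nbhs_pinfty_ge; rewrite num_real.
  rewrite sub0r opprK ger0_norm ?mulr_ge0 ?invr_ge0 ?powR_ge0 ?(ltW s1')//.
  by rewrite ler_pdivrMl// hA.
- by move=> x x0; have [|h _] := dF x; first lra.
- apply: cvg_at_right_filter; apply: cF; lra.
- move=> x; rewrite in_itv/= andbT => x0; rewrite derive1E.
  by have [|_ ->] := dF x; first lra.
Unshelve. all: end_near. Qed.

(** The integrand is even up to the factor [c], and on the positive axis (1 + x)^2 <= 2 (1 + x^2)
    reduces the claim to a shifted power of exponent 2 s > 1, which has an explicit primitive. *)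
Lemma integrable_bracket c s : 2^-1 < s ->
  mu.-integrable setT (EFin \o (fun x => c * (1 + x ^+ 2) `^ (- s))).
Proof.
move=> s1.
suff h : mu.-integrable setT (EFin \o (fun x => (1 + x ^+ 2) `^ (- s))).
  rewrite /comp; under eq_fun do rewrite EFinM.
  exact: integrableZl.
have cb := @continuous_bracket s.
apply/integrableP; split.
  by apply/measurable_EFinP; exact: continuous_measurable_fun.
under eq_integral do rewrite /= ger0_norm ?powR_ge0//.
rewrite ge0_symfun_integralT//; first last.
- by move=> x /=; rewrite sqrrN.
- by move=> x; exact: powR_ge0.
rewrite -set_itvcy.
apply: lte_mul_pinfty => //.
apply: (@le_lt_trans _ _ (\int[mu]_(x in `[0%R, +oo[) ((2 `^ s)%:E * ((1 + x) `^ (- (2 * s)))%:E))%E).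
  apply: ge0_le_integral => //.
  - by move=> x _; rewrite lee_fin powR_ge0.
  - by apply/measurable_EFinP; apply: measurable_funTS; exact: continuous_measurable_fun.
  - apply: emeasurable_funM => //; apply/measurable_EFinP.
    apply: measurableT_comp (@measurable_powR R (- (2 * s))) _.
    exact: measurable_funD.
  - move=> x /=; rewrite in_itv/= andbT => x0; rewrite -EFinM lee_fin.
    rewrite !powRN.
    have h : (1 + x) ^+ 2 <= 2 * (1 + x ^+ 2) by have := sqr_ge0 (x - 1); nra.
    have : ((1 + x) ^+ 2) `^ s <= (2 * (1 + x ^+ 2)) `^ s.
      by apply: ge0_ler_powR; rewrite ?nnegrE ?sqr_ge0 ?mulr_ge0 ?(ltW (bracket_gt0 x))//; lra.
    have b0 := bracket_gt0 x.
    have x1 : 0 < 1 + x by lra.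
    rewrite -(powR_mulrn 2 (ltW x1)) -powRrM (powRM _ _ (ltW b0))// => {}h.
    rewrite -[X in X <= _]mul1r ler_pdivrMr ?powR_gt0// mulrAC.
    by rewrite ler_pdivlMr ?powR_gt0// mul1r.
rewrite ge0_integralZl//.
- apply: lte_mul_pinfty => //.
  by apply: integral_onePx_lty; lra.
- apply/measurable_EFinP.
  apply: measurableT_comp (@measurable_powR R (- (2 * s))) _.
  exact: measurable_funD.
- by move=> x _; rewrite lee_fin powR_ge0.
Qed.

End bracket.

Section real_integrals.
Variable R : realType.
Local Notation mu := (@lebesgue_measure R).

Lemma measurable_EFin_continuous (f : R -> R) (D : set R) : continuous f ->
  measurable_fun D (EFin \o f).
Proof.
move=> cf; apply/measurable_EFinP; apply: measurable_funTS.
exact: continuous_measurable_fun.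
Qed.

Lemma le_integrable_continuous (f g : R -> R) : continuous f ->
  mu.-integrable setT (EFin \o g) -> (forall x, `|f x| <= g x) ->
  mu.-integrable setT (EFin \o f).
Proof.
move=> cf ig fg; apply: le_integrable ig => //.
  exact: measurable_EFin_continuous.
by move=> x _ /=; rewrite lee_fin (le_trans (fg x))// ler_norm.
Qed.

Lemma dominated_cvg_real (f_ : nat -> R -> R) (f g : R -> R) :
  (forall n, measurable_fun setT (f_ n)) -> measurable_fun setT f ->
  (forall x, f_ n x @[n --> \oo] --> f x) ->
  mu.-integrable setT (EFin \o g) -> (forall n x, `|f_ n x| <= g x) ->
  (\int[mu]_x (f_ n x)%:E)%E @[n --> \oo] --> (\int[mu]_x (f x)%:E)%E.
Proof.
move=> mf_ mf f_f ig fg.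
have mF n : measurable_fun setT (EFin \o f_ n) by apply/measurable_EFinP.
have mF0 : measurable_fun setT (EFin \o f) by apply/measurable_EFinP.
have cvF : {ae mu, forall x, setT x -> (EFin \o f_ n) x @[n --> \oo] --> (EFin \o f) x}.
  by apply: aeW => x _; apply/fine_cvgP; split; [exact: nearW|exact: f_f].
have bF : {ae mu, forall x n, setT x -> (`|(EFin \o f_ n) x| <= (EFin \o g) x)%E}.
  by apply: aeW => x n _; rewrite lee_fin.
by have [] := @dominated_convergence _ _ _ mu setT measurableT _ _ _ mF mF0 cvF ig bF.
Qed.

(** Truncations to growing intervals converge by domination, and their integrals are differences of
    boundary values, which tend to 0. *)
Lemma integral_derive0 (w w' g : R -> R) :
  (forall x : R, is_derive x 1 w (w' x)) -> continuous w' ->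
  mu.-integrable setT (EFin \o g) -> (forall x, `|w' x| <= g x) ->
  (forall e : R, 0 < e -> exists A, forall x, A <= `|x| -> `|w x| <= e) ->
  (\int[mu]_x (w' x)%:E = 0)%E.
Proof.
move=> dw cw' ig wg w0.
have cw : continuous w.
  by move=> x; have [h _] := dw x; apply: differentiable_continuous; exact/derivable1_diffP.
(* With [n.+1] the interval is nondegenerate for every [n], as the fundamental theorem of calculus
   demands. *)
pose J (n : nat) : set R := [set` `[- n.+1%:R, n.+1%:R]%R].
have mJ n : measurable (J n) by exact: measurable_itv.
have hJ n : (\int[mu]_x ((w' \_ (J n)) x)%:E = (w n.+1%:R - w (- n.+1%:R))%:E)%E.
  transitivity (\int[mu]_(x in J n) (w' x)%:E)%E.
    rewrite [RHS]integral_mkcond; apply: eq_integral => x _.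
    by rewrite /patch; case: ifP.
  rewrite EFinB; apply: continuous_FTC2.
  - by rewrite -subr_gt0 opprK addr_gt0.
  - exact: continuous_subspaceT.
  - split.
    + by move=> x _; have [] := dw x.
    + exact/cvg_at_right_filter/cw.
    + exact/cvg_at_left_filter/cw.
  - by move=> x _; rewrite derive1E; have [_ ->] := dw x.
have h1 : (\int[mu]_x ((w' \_ (J n)) x)%:E)%E @[n --> \oo] --> (\int[mu]_x (w' x)%:E)%E.
  apply: (@dominated_cvg_real _ _ g) => //.
  - move=> n; apply/(measurable_restrictT _ (mJ n)); apply: measurable_funTS.
    exact: continuous_measurable_fun.
  - exact: continuous_measurable_fun.
  - move=> x; apply: cvg_near_cst.
    near=> n; rewrite /patch mem_set// /J/= in_itv/= -ler_norml.
    rewrite (@le_trans _ _ n%:R)// ?ler_nat//.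
    near: n; exact: nbhs_infty_ger.
  - move=> n x; rewrite /patch; case: ifP => _; first exact: wg.
    by rewrite normr0 (le_trans _ (wg x)).
have h2 : (\int[mu]_x ((w' \_ (J n)) x)%:E)%E @[n --> \oo] --> 0%E.
  under eq_fun do rewrite hJ.
  apply/fine_cvgP; split; first exact: nearW.
  apply/cvgrPdist_le => e e0.
  have [A hA] := w0 (e / 2) (divr_gt0 e0 (ltr0n _ 2)).
  near=> n.
  have An : A <= n.+1%:R.
    by rewrite (@le_trans _ _ n%:R)// ?ler_nat//; near: n; exact: nbhs_infty_ger.
  rewrite sub0r normrN (le_trans (ler_normB _ _))// [leRHS]splitr lerD// hA//.
    by rewrite ger0_norm.
  by rewrite normrN ger0_norm.
exact: cvg_unique h1 h2.
Unshelve. all: end_near. Qed.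

End real_integrals.

(** * Cauchy's theorem in a half-plane *)

Section cauchy.
Local Open Scope complex_scope.
Variable R : realType.
Local Notation mu := (@lebesgue_measure R).
Local Notation Re := complex.Re.
Local Notation Im := complex.Im.

Lemma ler_norm_Re (w : R[i]) : `|Re w| <= normc w.
Proof.
rewrite -sqrtr_sqr; case: w => [a b] /=; apply: ler_wsqrtr.
by rewrite lerDl sqr_ge0.
Qed.

Lemma ler_norm_Im (w : R[i]) : `|Im w| <= normc w.
Proof.
rewrite -sqrtr_sqr; case: w => [a b] /=; apply: ler_wsqrtr.
by rewrite lerDr sqr_ge0.
Qed.

(* The integral of [N] along the line of depth [y] has derivative
   [- i \int N' = 0], hence is constant, and it tends to [0] with [N]. *)
Lemma cauchy_half_plane (N M : R -> R -> R[i]) (d s C1 C2 : R) :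
  2^-1 < s ->
  (forall x y, d < y -> is_cderive (N ^~ y) x (N x y * M x y)) ->
  (forall x y, d < y -> is_cderive (N x) y (- 'i * (N x y * M x y))) ->
  (forall x y, d < y -> ccontinuous_at (M ^~ y) x) ->
  (forall x y, d < y -> normc (N x y) <= C1 * (1 + x ^+ 2) `^ (- s)) ->
  (forall x y, d < y -> normc (M x y) <= C2) ->
  (forall x, Re (N x y) @[y --> +oo] --> (0 : R)) ->
  forall y, d < y ->
  mu.-integrable setT (fun x => (Re (N x y))%:E) /\
  (\int[mu]_x (Re (N x y))%:E = 0)%E.
Proof.
move=> s0 Nx Ny cM bN bM N0.
have C10 : 0 <= C1.
  have := le_trans (normc_ge0 _) (bN 0 (d + 1) _).
  by rewrite expr0n/= addr0 powR1 mulr1; apply; rewrite ltrDl.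
have C20 : 0 <= C2.
  by apply: le_trans (normc_ge0 _) (bM 0 (d + 1) _); rewrite ltrDl.
pose g x := C1 * (1 + x ^+ 2) `^ (- s).
have ig := integrable_bracket C1 s0.
pose G x := C1 * C2 * (1 + x ^+ 2) `^ (- s).
have iG := integrable_bracket (C1 * C2) s0.
(* Writing the derivative as [N * M] lets the decay of [N] and a uniform bound on [M] dominate it,
   with a majorant independent of the depth. *)
have bNM x y : d < y -> normc (N x y * M x y) <= G x.
  move=> dy; rewrite normcM (le_trans (ler_pM _ _ (bN x y dy) (bM x y dy))) ?normc_ge0//.
  by rewrite /G mulrAC.
have cRe y : d < y -> continuous (fun x => Re (N x y)).
  by move=> dy x; have [] := cderive_continuous (Nx x y dy).
have iu y : d < y -> mu.-integrable setT (EFin \o (fun x => Re (N x y))).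
  move=> dy; apply: le_integrable_continuous ig _; first exact: cRe.
  by move=> x; rewrite (le_trans (ler_norm_Re _))// bN.
have intIm y : d < y -> (\int[mu]_x (Im (N x y * M x y))%:E = 0)%E.
  move=> dy; apply: (@integral_derive0 _ (fun x => Im (N x y)) _ G) => //.
  - by move=> x; have [] := Nx x y dy.
  - move=> x; have [c1 c2] := cderive_continuous (Nx x y dy).
    have [m1 m2] := cM x y dy.
    rewrite /continuous_at cImM; under eq_fun do rewrite cImM.
    by apply: cvgD; apply: cvgM.
  - by move=> x; rewrite (le_trans (ler_norm_Im _))// bNM.
  - move=> e e0; have C11 : 0 < C1 + 1 by lra.
    have [|A A0 hA] := @bracket_small _ s (e / (C1 + 1)) _ (divr_gt0 e0 C11); first lra.
    exists A => x Ax; rewrite (le_trans (ler_norm_Im _))// (le_trans (bN x y dy))//.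
    apply: (@le_trans _ _ (C1 * (e / (C1 + 1)))); first by rewrite ler_wpM2l// hA.
    by rewrite mulrCA ler_piMr ?(ltW e0)// ler_pdivrMr ?mul1r//; lra.
pose I y := (\int[mu]_x Re (N x y))%R.
(* The depth derivative of Re N is Re (- i N M) = Im (N M), whose integral is 0 by [intIm]; [G]
   justifies differentiation under the integral. *)
have dI y : d < y -> is_derive y 1 I 0.
  move=> dy.
  have Iy : [set` `]d, (y + 1)[%R] y by rewrite /= in_itv/= dy ltrDl ltr01.
  have dNy x z : d < z -> is_derive z 1 (fun t => Re (N x t)) (Im (N x z * M x z)).
    move=> dz; have [h _] := Ny x z dz; apply: is_derive_eq h _.
    by rewrite cReM /=; ring.
  have D1 z x : d < z -> partial1of2 (fun t x => Re (N x t)) z x = Im (N x z * M x z).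
    by move=> dz; rewrite partial1of2E; have [_ ->] := dNy x z dz.
  have Id z : [set` `]d, (y + 1)[%R] z -> d < z by rewrite /= in_itv => /andP[].
  have h1 z : [set` `]d, (y + 1)[%R] z -> mu.-integrable setT (EFin \o (fun x => Re (N x z))).
    by move=> /Id; exact: iu.
  have h2 z x : [set` `]d, (y + 1)[%R] z -> setT x -> derivable (fun t => Re (N x t)) z 1.
    by move=> /Id dz _; have [] := dNy x z dz.
  have h3 x : 0 <= G x by rewrite mulr_ge0 ?powR_ge0// mulr_ge0.
  have h4 z x : [set` `]d, (y + 1)[%R] z -> setT x -> `|partial1of2 (fun t x => Re (N x t)) z x| <= G x.
    by move=> /Id dz _; rewrite D1// (le_trans (ler_norm_Im _))// bNM.
  split.
    exact: (@derivable_under_integral R _ _ mu (fun t x => Re (N x t)) setT measurableT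
       y d (y + 1) Iy h1 h2 G h3 iG h4).
  rewrite -derive1E (@differentiation_under_integral R _ _ mu (fun t x => Re (N x t)) setT measurableT
       y d (y + 1) Iy h1 h2 G h3 iG h4).
  under eq_Rintegral do rewrite D1//.
  by rewrite /Rintegral intIm.
have Icst y z : d < y -> y <= z -> I y = I z.
  move=> dy yz; apply/eqP; rewrite eq_le; apply/andP; split.
    apply: (@derive_ge0_le _ I (fun=> 0)) => // x /andP[yx _].
    by apply: dI; exact: lt_le_trans yx.
  apply: (@derive_le0_ge _ I (fun=> 0)) => // x /andP[yx _].
  by apply: dI; exact: lt_le_trans yx.
have EI y : d < y -> (\int[mu]_x (Re (N x y))%:E)%E = (I y)%:E.
  by move=> dy; rewrite fineK//; apply: integrable_fin_num => //; exact: iu.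
move=> y dy; split; first exact: iu.
have dyn n : d < y + n%:R by rewrite (lt_le_trans dy)// lerDl.
have h1 : (\int[mu]_x (Re (N x (y + n%:R)))%:E)%E @[n --> \oo] --> (\int[mu]_x (0 : R)%:E)%E.
  apply: (@dominated_cvg_real _ _ _ g) => //.
  - by move=> n; apply: continuous_measurable_fun; exact: cRe.
  - move=> x; apply: (cvg_comp _ _ _ (N0 x)).
    apply/cvgryPge => A; near=> n.
    have : A - y <= n%:R by near: n; exact: nbhs_infty_ger.
    by lra.
  - by move=> n x; rewrite (le_trans (ler_norm_Re _))// bN.
rewrite integral0 in h1.
have h2 : (\int[mu]_x (Re (N x (y + n%:R)))%:E)%E @[n --> \oo] --> (\int[mu]_x (Re (N x y))%:E)%E.
  apply: cvg_near_cst; apply: nearW => n.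
  by rewrite !EI// (@Icst y (y + n%:R))// lerDl.
exact: cvg_unique h2 h1.
Unshelve. all: end_near. Qed.

End cauchy.

Section continuity_closure.
Local Open Scope complex_scope.
Variable R : realType.

Lemma ccontinuous_cst (w : R[i]) t : ccontinuous_at (fun=> w) t.
Proof. by split; exact: cst_continuous. Qed.

Lemma ccontinuousD (f g : R -> R[i]) t :
  ccontinuous_at f t -> ccontinuous_at g t -> ccontinuous_at (fun s => f s + g s) t.
Proof.
move=> [f1 f2] [g1 g2]; split.
  by under eq_fun do rewrite cReD; exact: (continuousD f1 g1).
by under eq_fun do rewrite cImD; exact: (continuousD f2 g2).
Qed.

Lemma ccontinuousM (f g : R -> R[i]) t :
  ccontinuous_at f t -> ccontinuous_at g t -> ccontinuous_at (fun s => f s * g s) t.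
Proof.
move=> [f1 f2] [g1 g2]; split.
  under eq_fun do rewrite cReM.
  exact: (continuousB (continuousM f1 g1) (continuousM f2 g2)).
under eq_fun do rewrite cImM.
exact: (continuousD (continuousM f1 g2) (continuousM f2 g1)).
Qed.

Lemma ccontinuousV (f : R -> R[i]) t : f t != 0 ->
  ccontinuous_at f t -> ccontinuous_at (fun s => (f s)^-1) t.
Proof.
move=> f0 [f1 f2]; have n0 := lt0r_neq0 (Re2Im2_gt0 f0).
have hn : continuous_at t (fun s => (complex.Re (f s) ^+ 2 + complex.Im (f s) ^+ 2)^-1).
  apply: (@continuousV _ _ (fun s => complex.Re (f s) ^+ 2 + complex.Im (f s) ^+ 2)) => //.
  exact: (continuousD (continuousM f1 f1) (continuousM f2 f2)).
split.
  by under eq_fun do rewrite cReV; exact: (continuousM f1 hn).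
by under eq_fun do rewrite cImV; exact: (continuousN (continuousM f2 hn)).
Qed.

End continuity_closure.

(** * Estimates for a single pole *)

Section pole.
Local Open Scope complex_scope.
Variable R : realType.
Implicit Types (x y d : R) (l w : R[i]).
Local Notation Re := complex.Re.
Local Notation Im := complex.Im.

Lemma normc_cReal (a : R) : normc a%:C = `|a|.
Proof. by rewrite /normc /= expr0n addr0 sqrtr_sqr. Qed.

Lemma normc_sum (I : Type) (r : seq I) (f : I -> R[i]) :
  normc (\sum_(i <- r) f i) <= \sum_(i <- r) normc (f i).
Proof.
elim: r => [|i r IH]; first by rewrite !big_nil normc0.
by rewrite !big_cons (le_trans (le_normcD _ _))// lerD2l.
Qed.

Lemma cderive_lin (a b : R) (w : R[i]) (t : R) :
  is_cderive (fun s => (a * s) +i* (b * s) + w) t (a +i* b).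
Proof.
split; rewrite /=.
  under eq_fun do rewrite cReD /=.
  apply: is_derive_eq (is_deriveD (is_deriveZ a (is_derive_id t 1)) (is_derive_cst (Re w) t 1)) _.
  by rewrite addr0 -![_ *: _]/(_ * _) mulr1.
under eq_fun do rewrite cImD /=.
apply: is_derive_eq (is_deriveD (is_deriveZ b (is_derive_id t 1)) (is_derive_cst (Im w) t 1)) _.
by rewrite addr0 -![_ *: _]/(_ * _) mulr1.
Qed.

(* The point [x - i y]: all functions below are holomorphic in the lower half
   plane, which is parametrised by its depth [y]. *)
Definition zeta x y : R[i] := x -i* y.

Lemma cderive_zeta_x l x y : is_cderive (fun s => zeta s y - l) x 1.
Proof.
have -> : (fun s => zeta s y - l) = (fun s => (1 * s) +i* (0 * s) + (zeta 0 y - l)).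
  apply/funext => s; rewrite /zeta; case: l => [a b].
  by apply/eqP; rewrite eq_complex /=; apply/andP; split; apply/eqP; ring.
exact: cderive_lin.
Qed.

Lemma cderive_zeta_y l x y : is_cderive (fun s => zeta x s - l) y (- 'i).
Proof.
have -> : (fun s => zeta x s - l) = (fun s => (- 0 * s) +i* (- 1 * s) + (zeta x 0 - l)).
  apply/funext => s; rewrite /zeta; case: l => [a b].
  by apply/eqP; rewrite eq_complex /=; apply/andP; split; apply/eqP; ring.
exact: cderive_lin.
Qed.

Variable e : R.
Hypothesis e0 : 0 < e.

Section one_pole.
Variable l : R[i].
Hypothesis le : 2 * e <= Im l.
Variables x y : R.
Hypothesis ye : - e < y.

(** The margin [2 * e] against depths down to [- e] leaves a distance of more than [e] to the pole,
    so bounds in terms of [e] also cover a neighbourhood of the line. *)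
Lemma pole_depth : e < y + Im l.
Proof. move: e0 le ye => h1 h2 h3; lra. Qed.

Lemma zeta_sub_norm : y + Im l <= normc (zeta x y - l).
Proof.
apply: le_trans (ler_norm_Im _); rewrite cImD.
by case: l => a b /=; rewrite -opprD normrN ler_norm.
Qed.

Lemma zeta_sub_neq0 : zeta x y - l != 0.
Proof.
apply/eqP => h; have := zeta_sub_norm; rewrite h normc0 leNgt => /negP; apply.
exact: lt_trans e0 pole_depth.
Qed.

Lemma pole_norm_le : normc (zeta x y - l)^-1 <= (y + Im l)^-1.
Proof.
have h := lt_trans e0 pole_depth.
by rewrite normcV lef_pV2 ?zeta_sub_norm// posrE// normc_gt0// zeta_sub_neq0.
Qed.

Lemma pole_norm_le_e : normc (zeta x y - l)^-1 <= e^-1.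
Proof.
apply: le_trans pole_norm_le _; have h := pole_depth.
by rewrite lef_pV2 ?posrE ?(lt_trans e0 h)// ltW.
Qed.

(** With a = Re l, 1 + x^2 <= 2 (x - a)^2 + (1 + 2 a^2), and the last summand is a multiple of e^2,
    which is at most the squared imaginary part of [zeta x y - l]. *)
Definition pole_const : R := Num.sqrt (2 + (1 + 2 * Re l ^+ 2) / e ^+ 2).

Lemma pole_norm_bracket :
  normc (zeta x y - l)^-1 <= pole_const * (1 + x ^+ 2) `^ (- 2^-1).
Proof.
have b0 := bracket_gt0 x; have n0 := normc_gt0 zeta_sub_neq0.
rewrite normcV powRN powR12_sqrt ?(ltW b0)// ler_pdivlMr ?sqrtr_gt0// mulrC ler_pdivrMr//.
rewrite -[X in _ * X](ger0_norm (ltW n0)) -[`|normc _|]sqrtr_sqr -sqrtrM.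
  apply: ler_wsqrtr; rewrite sqr_normcE.
  have hIm : e ^+ 2 <= Im (zeta x y - l) ^+ 2.
    have h := pole_depth; rewrite cImD; move: e0 h.
    by case: l => a b /= h1 h2; nra.
  have -> : Re (zeta x y - l) = x - Re l by rewrite cReD; case: l.
  have e2 : 0 < e ^+ 2 by rewrite exprn_gt0.
  apply: (@le_trans _ _ ((2 + (1 + 2 * Re l ^+ 2) / e ^+ 2) * ((x - Re l) ^+ 2 + e ^+ 2))).
    rewrite mulrDl (mulrDr ((1 + 2 * Re l ^+ 2) / e ^+ 2)) divfK ?gt_eqF//.
    have h3 : 0 <= (1 + 2 * Re l ^+ 2) / e ^+ 2 * (x - Re l) ^+ 2.
      rewrite mulr_ge0 ?sqr_ge0// divr_ge0 ?sqr_ge0//.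
      by rewrite addr_ge0// mulr_ge0// sqr_ge0.
    have := sqr_ge0 (x - 2 * Re l); nra.
  rewrite ler_wpM2l ?lerD2l// addr_ge0// divr_ge0 ?sqr_ge0//.
  by rewrite addr_ge0// mulr_ge0// sqr_ge0.
rewrite addr_ge0// divr_ge0 ?sqr_ge0//.
by rewrite addr_ge0// mulr_ge0// sqr_ge0.
Qed.

End one_pole.

Lemma pole_const_ge0 l : 0 <= pole_const l. Proof. exact: sqrtr_ge0. Qed.

End pole.

(** * Products and sums of poles *)

Section pole_products.
Local Open Scope complex_scope.
Variable R : realType.
Implicit Types (x y d e : R) (c l w : R[i]) (L : seq R[i]).
Local Notation Re := complex.Re.
Local Notation Im := complex.Im.
Local Notation mu := (@lebesgue_measure R).

(* [M] is the logarithmic derivative of [N] in the variable [zeta x y]. *)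
Definition log_holomorphic d (N M : R -> R -> R[i]) :=
  [/\ forall x y, d < y -> is_cderive (N ^~ y) x (N x y * M x y),
      forall x y, d < y -> is_cderive (N x) y (- 'i * (N x y * M x y)) &
      forall x y, d < y -> ccontinuous_at (M ^~ y) x].

Definition poles_above e L := all (fun l => 2 * e <= Im l) L.

Definition poles_prod L x y : R[i] := \prod_(l <- L) (zeta x y - l)^-1.
(** It serves twice: up to sign it is the logarithmic derivative of [poles_prod L], and at [y = 0]
    it is one of the two halves of rho. *)
Definition poles_sum L x y : R[i] := \sum_(l <- L) (zeta x y - l)^-1.

Lemma log_holomorphicM d N1 M1 N2 M2 :
  log_holomorphic d N1 M1 -> log_holomorphic d N2 M2 ->
  log_holomorphic d (fun x y => N1 x y * N2 x y) (fun x y => M1 x y + M2 x y).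
Proof.
move=> [x1 y1 c1] [x2 y2 c2]; split=> x y dy.
- by apply: is_cderive_eq (cderiveM (x1 x y dy) (x2 x y dy)) _; ring.
- by apply: is_cderive_eq (cderiveM (y1 x y dy) (y2 x y dy)) _; ring.
- by apply: ccontinuousD; [exact: c1|exact: c2].
Qed.

Lemma log_holomorphic_cst d c : log_holomorphic d (fun _ _ => c) (fun _ _ => 0).
Proof.
split=> x y dy; last exact: ccontinuous_cst.
  by rewrite mulr0; exact: cderive_cst.
by rewrite !mulr0; exact: cderive_cst.
Qed.

Section fixed_depth.
Variable e : R.
Hypothesis e0 : 0 < e.

Lemma log_holomorphic_pole l : 2 * e <= Im l ->
  log_holomorphic (- e) (fun x y => (zeta x y - l)^-1) (fun x y => - (zeta x y - l)^-1).
Proof.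
move=> le; split=> x y ye; have z0 := zeta_sub_neq0 e0 le x ye.
- apply: is_cderive_eq (cderiveV z0 (cderive_zeta_x l x y)) _.
  by rewrite expr2 invfM; ring.
- apply: is_cderive_eq (cderiveV z0 (cderive_zeta_y l x y)) _.
  by rewrite expr2 invfM; ring.
- under eq_fun do rewrite -mulN1r.
  apply: ccontinuousM; first exact: ccontinuous_cst.
  exact: (cderive_continuous (cderiveV z0 (cderive_zeta_x l x y))).
Qed.

Lemma log_holomorphic_poles_prod L : poles_above e L ->
  log_holomorphic (- e) (poles_prod L) (fun x y => - poles_sum L x y).
Proof.
elim: L => [_|l L IH /= /andP[le /IH{}IH]].
  have -> : poles_prod [::] = (fun _ _ => 1) :> (R -> R -> R[i]).
    by do 2!apply/funext => ?; rewrite /poles_prod big_nil.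
  have -> : (fun x y => - poles_sum [::] x y) = (fun _ _ => 0) :> (R -> R -> R[i]).
    by do 2!apply/funext => ?; rewrite /poles_sum big_nil oppr0.
  exact: log_holomorphic_cst.
have := log_holomorphicM (log_holomorphic_pole le) IH.
congr log_holomorphic; do 2!apply/funext => ?.
  by rewrite /poles_prod big_cons.
by rewrite /poles_sum big_cons opprD.
Qed.

Lemma poles_prod_bracket L : poles_above e L ->
  exists2 C, 0 <= C & forall x y, - e < y ->
    normc (poles_prod L x y) <= C * (1 + x ^+ 2) `^ (- (size L)%:R / 2).
Proof.
elim: L => [_|l L IH /= /andP[le /IH[C C0 hC]]].
  exists 1 => // x y _; rewrite /poles_prod big_nil normc1 mul1r.
  by rewrite oppr0 mul0r powRr0.
exists (pole_const e l * C) => [|x y ye]; first by rewrite mulr_ge0// pole_const_ge0.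
rewrite /poles_prod big_cons normcM.
have b0 := bracket_gt0 x.
have -> : - (size L).+1%:R / 2 = - 2^-1 + - (size L)%:R / 2 :> R.
  by rewrite -natr1; field.
rewrite powRD; last by rewrite (gt_eqF b0) implybT.
rewrite mulrACA ler_pM ?normc_ge0//; last exact: hC.
exact: (pole_norm_bracket e0 le).
Qed.

Lemma poles_sum_bound L : poles_above e L ->
  forall x y, - e < y -> normc (poles_sum L x y) <= (size L)%:R / e.
Proof.
move=> Le x y ye; rewrite /poles_sum (le_trans (normc_sum _ _))//.
elim: L Le => [_|l L IH /= /andP[le /IH{}IH]]; first by rewrite big_nil mul0r.
rewrite big_cons -nat1r mulrDl mul1r lerD//.
exact: (pole_norm_le_e e0 le).
Qed.

Lemma cvg_depth_invr (b C : R) (f : R -> R) : (forall y, - b < y -> `|f y| <= C / (y + b)) ->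
  f y @[y --> +oo] --> (0 : R).
Proof.
move=> hf; apply/cvgrPdist_le => r r0; near=> y.
have yb : 0 < y + b.
  by rewrite -ltrBlDr sub0r; near: y; apply: nbhs_pinfty_gt; rewrite num_real.
rewrite sub0r normrN (le_trans (hf _ _))//; first by lra.
rewrite ler_pdivrMr// mulrC -ler_pdivrMr//.
have : C / r - b <= y by near: y; apply: nbhs_pinfty_ge; rewrite num_real.
by lra.
Unshelve. all: end_near. Qed.

Lemma poles_prod_cvg0 c L : poles_above e L -> (0 < size L)%N -> forall x,
  Re (c * poles_prod L x y) @[y --> +oo] --> (0 : R).
Proof.
case: L => // l L /= /andP[le Le] _ x.
have [C C0 hC] := poles_prod_bracket Le.
apply: (@cvg_depth_invr e (normc c * C * (1 + x ^+ 2) `^ (- (size L)%:R / 2))) => y ye.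
rewrite (le_trans (ler_norm_Re _))// normcM -!mulrA ler_wpM2l ?normc_ge0//.
rewrite /poles_prod big_cons normcM mulrC mulrA ler_pM ?normc_ge0//; first exact: hC.
rewrite (le_trans (pole_norm_le e0 le x ye))// lef_pV2 ?posrE.
- by move: e0 le => h1 h2; lra.
- exact: lt_trans (pole_depth e0 le ye).
- by move: ye => h; lra.
Qed.

(** Two poles or more push the decay exponent, half their number, above the threshold 1/2 of
    [cauchy_half_plane]. *)
Lemma integral_poles_prod c L y : poles_above e L -> (1 < size L)%N -> - e < y ->
  mu.-integrable setT (fun x => (Re (c * poles_prod L x y))%:E) /\
  (\int[mu]_x (Re (c * poles_prod L x y))%:E = 0)%E.
Proof.
move=> Le sL ye; have [C C0 hC] := poles_prod_bracket Le.
have [cx cy cM] := log_holomorphicM (log_holomorphic_cst (- e) c) (log_holomorphic_poles_prod Le).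
apply: (@cauchy_half_plane _ (fun x y => c * poles_prod L x y) _ (- e)
  ((size L)%:R / 2) (normc c * C) ((size L)%:R / e) _ cx cy cM) => //.
- by rewrite -[ltLHS]mul1r ltr_pM2r// ltr1n.
- move=> x z ze; rewrite normcM -mulrA ler_wpM2l ?normc_ge0// -mulNr.
  exact: hC.
- by move=> x z ze; rewrite add0r normcN; exact: poles_sum_bound.
- by move=> x; apply: poles_prod_cvg0 => //; exact: ltnW.
Qed.

End fixed_depth.
End pole_products.

(** * Integrals of rational functions *)

Section rational.
Local Open Scope complex_scope.
Variable R : realType.
Implicit Types (x y d e : R) (c l w z : R[i]) (L : seq R[i]) (P : {poly R[i]}).
Local Notation Re := complex.Re.
Local Notation Im := complex.Im.
Local Notation mu := (@lebesgue_measure R).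

Lemma zeta0 x : zeta x 0 = x%:C.
Proof. by rewrite /zeta oppr0. Qed.

Lemma root_factor_size P z k : root P z -> (size P <= k.+1)%N ->
  exists2 Q : {poly R[i]}, P = Q * ('X - z%:P) & (size Q <= k)%N.
Proof.
move=> /factor_theorem[Q PE] sP; exists Q => //.
have [->|Q0] := eqVneq Q 0; first by rewrite size_poly0.
move: sP; rewrite PE size_Mmonic ?monicXsubC// size_XsubC addn2 /=.
by [].
Qed.

Section fixed_depth.
Variable e : R.
Hypothesis e0 : 0 < e.

Lemma eN0 : - e < 0. Proof. by rewrite oppr_lt0. Qed.

Lemma pole_neq0 l x : 2 * e <= Im l -> x%:C - l != 0.
Proof. by move=> le; have := zeta_sub_neq0 e0 le x eN0; rewrite zeta0. Qed.

(** The size condition makes the quotient decay at least like x^(-2). Dividing [P] by ['X - l%:P]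
    splits off the constant [P.[l]] over all the poles and leaves a quotient with one pole fewer and
    again the right size. *)
Lemma integral_rational L P : poles_above e L -> (size P < size L)%N ->
  mu.-integrable setT (fun x => (Re (P.[x%:C] * poles_prod L x 0))%:E) /\
  (\int[mu]_x (Re (P.[x%:C] * poles_prod L x 0))%:E = 0)%E.
Proof.
elim: L P => // l L IH P /= /andP[le Le] sP.
have [->|P0] := eqVneq P 0.
  under eq_fun do rewrite horner0 mul0r /=.
  by split; [exact: integrable0|rewrite integral0].
have sL : (0 < size L)%N by rewrite -ltnS (leq_trans _ sP)// ltnS size_poly_gt0.
have rl : root (P - P.[l]%:P) l by rewrite /root hornerD hornerN hornerC subrr.
have [|Q PE sQ] := @root_factor_size _ l (size P).-1 rl.
  rewrite prednK ?size_poly_gt0// (leq_trans (size_polyD _ _))// geq_max leqnn/=.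
  by rewrite size_polyN (leq_trans (size_polyC_leq1 _))// size_poly_gt0.
have {}sQ : (size Q < size L)%N.
  by rewrite (leq_ltn_trans sQ)// -ltnS prednK// size_poly_gt0.
have [i1 I1] := IH Q Le sQ.
have Lle : poles_above e (l :: L) by rewrite /poles_above /= le.
have [i2 I2] := @integral_poles_prod R e e0 P.[l] (l :: L) 0 Lle sL eN0.
have E x : (Re (P.[x%:C] * poles_prod (l :: L) x 0))%:E =
  ((Re (Q.[x%:C] * poles_prod L x 0))%:E + (Re (P.[l] * poles_prod (l :: L) x 0))%:E)%E.
  rewrite -EFinD -cReD; congr (Re _)%:E.
  have -> : P.[x%:C] = Q.[x%:C] * (x%:C - l) + P.[l].
    have : (P - P.[l]%:P).[x%:C] = (Q * ('X - l%:P)).[x%:C] by rewrite PE.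
    rewrite hornerD hornerN hornerC hornerM hornerXsubC => /eqP.
    by rewrite subr_eq => /eqP.
  rewrite mulrDl; congr (_ + _).
  rewrite /poles_prod big_cons zeta0 mulrA; congr (_ * _).
  by rewrite mulfK// pole_neq0.
under eq_fun do rewrite E.
split; first exact: integrableD.
by rewrite integralD// I1 I2 adde0.
Qed.

Lemma normc_pole_sqr l x :
  normc (x%:C - l)^-1 ^+ 2 = ((x - Re l) ^+ 2 + Im l ^+ 2)^-1.
Proof.
rewrite normcV exprVn sqr_normcE cReD cImD.
by case: l => a b /=; rewrite add0r sqrrN.
Qed.

Lemma continuous_cauchy_kernel (a b : R) : b != 0 ->
  continuous (fun x => ((x - a) ^+ 2 + b ^+ 2)^-1).
Proof.
move=> b0 x; apply: (@continuousV _ _ (fun x => (x - a) ^+ 2 + b ^+ 2)).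
  by rewrite gt_eqF// ltr_wpDl ?sqr_ge0// exprn_even_gt0.
have c1 : continuous_at x (fun x => x - a).
  by apply: (@continuousB _ _ _ id (cst a) x); [exact: cvg_id|exact: cst_continuous].
by apply: (@continuousD _ _ _ (fun x => (x - a) ^+ 2) (cst (b ^+ 2)) x);
  [exact: (continuousM c1 c1)|exact: cst_continuous].
Qed.

(** The integral over [a - r, a + r] is 2 / b * atan (r / b), a lower bound that tends to pi / b. *)
Lemma integral_cauchy_kernel (a b : R) : 0 < b ->
  ((pi / b)%:E <= \int[mu]_x (((x - a) ^+ 2 + b ^+ 2)^-1)%:E)%E.
Proof.
move=> b0.
have b0' : b != 0 by rewrite gt_eqF.
pose F x := b^-1 * atan ((x - a) / b).
have dF x : is_derive x 1 F (((x - a) ^+ 2 + b ^+ 2)^-1).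
  have h1 : is_derive x 1 (fun x : R => (x - a) / b) b^-1.
    apply: is_derive_eq (is_deriveM (is_deriveB (is_derive_id x 1) (is_derive_cst a x 1)) (is_derive_cst b^-1 x 1)) _.
    by rewrite -![_ *: _]/(_ * _) mulr0 add0r subr0 mulr1.
  apply: is_derive_eq (is_deriveZ b^-1 (@is_derive1_comp _ (@atan R) (fun x : R => (x - a) / b) x _ _ (is_derive1_atan _) h1)) _.
  rewrite -![_ *: _]/(_ * _).
  have : (x - a) ^+ 2 + b ^+ 2 != 0 by rewrite gt_eqF// ltr_wpDl ?sqr_ge0// exprn_even_gt0.
  have -> : 1 + ((x - a) / b) ^+ 2 = ((x - a) ^+ 2 + b ^+ 2) / b ^+ 2 by field.
  by move: (_ + _) => D h; field; rewrite b0' h.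
have cF x : {for x, continuous F}.
  by have [h _] := dF x; apply: differentiable_continuous; exact/derivable1_diffP.
have ck := continuous_cauchy_kernel (a:=a) b0'.
have low r : 0 < r -> ((2 / b * atan (r / b))%:E <= \int[mu]_x (((x - a) ^+ 2 + b ^+ 2)^-1)%:E)%E.
  move=> r0.
  have -> : (2 / b * atan (r / b))%:E = (\int[mu]_(x in [set` `[(a - r)%R, (a + r)%R]%R]) (((x - a) ^+ 2 + b ^+ 2)^-1)%:E)%E.
    rewrite (@continuous_FTC2 _ _ F).
    - rewrite -EFinB /F; congr (_%:E).
      have -> : a - r - a = - r by ring.
      have -> : a + r - a = r by ring.
      by rewrite mulNr atanN; ring.
    - lra.
    - exact: continuous_subspaceT.
    - split.
      + by move=> x _; have [] := dF x.
      + exact/cvg_at_right_filter/cF.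
      + exact/cvg_at_left_filter/cF.
    - by move=> x _; rewrite derive1E; have [_ ->] := dF x.
  apply: ge0_subset_integral => //.
  - exact: measurable_EFin_continuous.
  - by move=> x _; rewrite lee_fin invr_ge0 addr_ge0 ?sqr_ge0.
set J := (\int[mu]_x _)%E in low *.
have h1 : \forall r \near +oo, ((2 / b * atan (r / b))%:E <= J)%E.
  by near=> r; apply: low; near: r; apply: nbhs_pinfty_gt; rewrite num_real.
have h2 : (2 / b * atan (r / b))%:E @[r --> +oo] --> (pi / b)%:E.
  apply/fine_cvgP; split; first exact: nearW.
  have -> : pi / b = 2 / b * (pi / 2) by field.
  apply: cvgM; first exact: cvg_cst.
  apply: cvg_comp (@cvgy_atan R).
  apply/cvgryPge => A; near=> r.
  by rewrite ler_pdivlMr//; near: r; apply: nbhs_pinfty_ge; rewrite num_real.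
exact: cvge_le h1 h2.
Unshelve. all: end_near. Qed.

End fixed_depth.
End rational.

(** Cauchy-Schwarz for two terms, free of square roots. It merges the bound for [f] with that for
    the added orthogonal function in the induction of [rational_sup_bound]. *)
Lemma cauchy_schwarz2 (R : realDomainType) (u v p q r t : R) :
  0 <= u -> 0 <= v -> 0 <= p -> 0 <= q -> 0 <= r -> 0 <= t ->
  u ^+ 2 <= p * q -> v ^+ 2 <= r * t -> (u + v) ^+ 2 <= (p + r) * (q + t).
Proof.
move=> u0 v0 p0 q0 r0 t0 hu hv.
have : (2 * (u * v)) ^+ 2 <= (p * t + r * q) ^+ 2.
  have : (u * v) ^+ 2 <= (p * t) * (r * q).
    rewrite exprMn (_ : p * t * (r * q) = (p * q) * (r * t)); last by ring.
    by rewrite ler_pM ?sqr_ge0.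
  by have := sqr_ge0 (p * t - r * q); nra.
rewrite ler_pXn2r ?nnegrE ?addr_ge0 ?mulr_ge0// => h.
by rewrite sqrrD; lra.
Qed.

(** * Pointwise bounds by Malmquist-Takenaka expansion *)

Section malmquist_takenaka.
Local Open Scope complex_scope.
Variable R : realType.
Implicit Types (x y d e : R) (c l w z : R[i]) (L : seq R[i]) (P : {poly R[i]}).
Local Notation Re := complex.Re.
Local Notation Im := complex.Im.
Local Notation mu := (@lebesgue_measure R).

Lemma normc_conj w : normc (conjc w) = normc w.
Proof. by case: w => a b; rewrite /normc /= sqrrN. Qed.

Lemma conjc_subr x l : conjc (x%:C - l) = x%:C - conjc l.
Proof. by case: l => a b; apply/eqP; rewrite eq_complex /= !sub0r !eqxx. Qed.

Lemma normcD_sqr (u v : R[i]) :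
  normc (u + v) ^+ 2 = normc u ^+ 2 + normc v ^+ 2 + 2 * Re (conjc u * v).
Proof. by rewrite !sqr_normcE cReM cReD cImD; case: u v => [a b] [c d] /=; ring. Qed.

(** Times [poles_prod L], this is the Blaschke product with poles [L], of modulus 1 on the line. *)
Definition mirror_poly L : {poly R[i]} := \prod_(l <- L) ('X - (conjc l)%:P).

Lemma mirror_polyE L x : (mirror_poly L).[x%:C] = \prod_(l <- L) (x%:C - conjc l).
Proof. by rewrite horner_prod; apply: eq_bigr => l _; rewrite hornerXsubC. Qed.

Section fixed_depth.
Variable e : R.
Hypothesis e0 : 0 < e.

Lemma normc_blaschke L x : poles_above e L ->
  normc ((mirror_poly L).[x%:C] * poles_prod L x 0) = 1.
Proof.
rewrite mirror_polyE; elim: L => [_|l L IH /= /andP[le /IH{}IH]].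
  by rewrite big_nil /poles_prod big_nil mulr1 normc1.
rewrite big_cons /poles_prod big_cons mulrACA normcM IH mulr1 zeta0 normcM.
by rewrite -conjc_subr normc_conj -normcM divff ?normc1// (pole_neq0 e0 x le).
Qed.

(** Each pole contributes its Poisson kernel, up to a factor pi; the recursive form matches the
    induction on the poles below. *)
Lemma Im_poles_sum l L x : Im (poles_sum (l :: L) x 0) =
  Im l * normc (x%:C - l)^-1 ^+ 2 + Im (poles_sum L x 0).
Proof.
rewrite /poles_sum big_cons cImD zeta0; congr (_ + _).
rewrite normc_pole_sqr cImV cReD cImD.
by case: l => a b /=; rewrite add0r sqrrN; ring.
Qed.

Lemma Im_poles_sum_ge0 L x : poles_above e L -> 0 <= Im (poles_sum L x 0).
Proof.
elim: L => [_|l L IH /= /andP[le /IH{}IH]]; first by rewrite /poles_sum big_nil.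
rewrite Im_poles_sum addr_ge0// mulr_ge0 ?sqr_ge0//.
by move: e0 le => h1 h2; lra.
Qed.

Lemma continuous_sqr_pole l : 2 * e <= Im l ->
  continuous (fun x => normc (x%:C - l)^-1 ^+ 2).
Proof.
move=> le; under eq_fun do rewrite normc_pole_sqr.
apply: continuous_cauchy_kernel.
by rewrite gt_eqF//; move: e0 le => h1 h2; lra.
Qed.

Lemma integrable_sqr_pole l : 2 * e <= Im l ->
  mu.-integrable setT (fun x => (normc (x%:C - l)^-1 ^+ 2)%:E).
Proof.
move=> le; have h1 : 2^-1 < 1 :> R by rewrite invf_lt1// ltr1n.
apply: (le_integrable_continuous (continuous_sqr_pole le)
  (integrable_bracket (pole_const e l ^+ 2) h1)) => x.
rewrite ger0_norm ?sqr_ge0//.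
have := pole_norm_bracket e0 le x (eN0 e0).
rewrite zeta0 => h.
have -> : (1 + x ^+ 2) `^ (- 1) = ((1 + x ^+ 2) `^ (- 2^-1)) ^+ 2.
  rewrite -(powR_mulrn 2 (powR_ge0 _ (- 2^-1))) -powRrM.
  by congr (_ `^ _); field.
rewrite -(exprMn 2) lerXn2r ?nnegrE ?normc_ge0 ?mulr_ge0 ?powR_ge0//.
exact: pole_const_ge0.
Qed.

(* With [z] the first pole, [P / Q] is [f + c * g], where [f] is rational with the
   remaining poles and [g] is the Malmquist-Takenaka function of [z], orthogonal
   to [f]; this adds [Im z / |x - z|^2] to the bound for [f]. *)
Lemma rational_sup_bound L P : poles_above e L -> (size P <= size L)%N ->
  mu.-integrable setT (fun x => (normc (P.[x%:C] * poles_prod L x 0) ^+ 2)%:E) /\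
  forall x, ((normc (P.[x%:C] * poles_prod L x 0) ^+ 2)%:E <=
    (Im (poles_sum L x 0) / pi)%:E *
    \int[mu]_t (normc (P.[t%:C] * poles_prod L t 0) ^+ 2)%:E)%E.
Proof.
elim: L P => [|z L IH] P.
  move=> _; rewrite leqn0 size_poly_eq0 => /eqP ->.
  under eq_fun do rewrite horner0 mul0r normc0 expr0n/=.
  split; first exact: integrable0.
  move=> x; rewrite horner0 mul0r normc0 expr0n /poles_sum big_nil mul0r mul0e.
  exact: lexx.
move=> /= /andP[le Le] sP.
have b0 : 0 < Im z by move: e0 le => h1 h2; lra.
pose B := mirror_poly L.
(* The zeros of [B] are conjugates of poles, hence in the lower half-plane, while [z] is in the
   upper one. *)
have Bz0 : B.[z] != 0.
  rewrite /B /mirror_poly horner_prod; elim: (L) Le => [_|l L' IHL /= /andP[le' /IHL{}IHL]].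
    by rewrite big_nil oner_eq0.
  rewrite big_cons mulf_neq0// hornerXsubC.
  apply/eqP => /(congr1 (@complex.Im R)) /=; rewrite cImD.
  by case: l le' => a b /= le' h; move: e0 b0 le' h => h1 h2 h3 h4; lra.
have sB : (size B <= (size L).+1)%N by rewrite /B /mirror_poly size_prod_XsubC.
(* This value makes [P - c *: B] vanish at [z], so that the pole [z] cancels in [f]. *)
pose c := P.[z] / B.[z].
have rz : root (P - c *: B) z by rewrite /root hornerD hornerN hornerZ divfK// subrr.
have sPB : (size (P - c *: B)%R <= (size L).+1)%N.
  rewrite (leq_trans (size_polyD _ _))// geq_max sP size_polyN.
  exact: leq_trans (size_scale_leq _ _) sB.
have [Q PE sQ] := root_factor_size rz sPB.
have [iQ hQ] := IH Q Le sQ.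
pose f x := Q.[x%:C] * poles_prod L x 0.
pose g x := B.[x%:C] * poles_prod (z :: L) x 0.
have fE x : P.[x%:C] * poles_prod (z :: L) x 0 = f x + c * g x.
  have -> : P.[x%:C] = Q.[x%:C] * (x%:C - z) + c * B.[x%:C].
    have : (P - c *: B).[x%:C] = (Q * ('X - z%:P)).[x%:C] by rewrite PE.
    rewrite hornerD hornerN hornerZ hornerM hornerXsubC => /eqP.
    by rewrite subr_eq => /eqP.
  rewrite mulrDl -mulrA; congr (_ + _).
  rewrite /f /poles_prod big_cons zeta0 -mulrA; congr (_ * _).
  by rewrite mulrA divff ?mul1r// (pole_neq0 e0 x le).
have gE x : normc (g x) = normc (x%:C - z)^-1.
  rewrite /g /poles_prod big_cons -/(poles_prod L x 0) zeta0 mulrCA normcM.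
  by rewrite normc_blaschke// mulr1.
(* Orthogonality: on the line the denominators of conj f are exactly the factors of [B]. After
   cancellation only poles of the upper half-plane remain, and [integral_rational] applies. *)
have crossE x : Re (conjc (f x) * (c * g x)) =
    Re ((c *: map_poly (@conjc _) Q).[x%:C] * poles_prod (z :: L) x 0).
  congr Re.
  have -> : conjc (f x) = (map_poly (@conjc _) Q).[x%:C] * \prod_(l <- L) (x%:C - conjc l)^-1.
    rewrite /f rmorphM; congr (_ * _).
      by rewrite -{2}[x%:C]conjc_real horner_map.
    rewrite /poles_prod rmorph_prod; apply: eq_bigr => l _.
    by rewrite fmorphV zeta0 -conjc_subr.
  rewrite /g /B mirror_polyE hornerZ.
  have h : (\prod_(l <- L) (x%:C - conjc l)^-1) * (\prod_(l <- L) (x%:C - conjc l)) = 1.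
    rewrite -big_split /= big1_seq// => l /andP[_ lL].
    rewrite mulVf//; apply/eqP => /(congr1 (@complex.Im R)); rewrite cImD.
    have : 2 * e <= Im l by move/allP: Le; apply.
    by case: (l) => a b /= h3 h4; move: e0 h3 h4 => h1 h2 h3; lra.
  set A := \prod_(l <- L) (x%:C - conjc l)^-1 in h *.
  set D := \prod_(l <- L) (x%:C - conjc l) in h *.
  transitivity (c * (map_poly (@conjc _) Q).[x%:C] * (A * D) * poles_prod (z :: L) x 0).
    by ring.
  by rewrite h mulr1.
have Lz : poles_above e (z :: L) by rewrite /= le.
have sQc : (size (c *: map_poly (@conjc _) Q) < size (z :: L))%N.
  by rewrite ltnS (leq_trans (size_scale_leq _ _))// (leq_trans (size_poly _ _)).
have [ix Ix] := integral_rational e0 Lz sQc.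
have ig := integrable_sqr_pole le.
have sqE x : normc (P.[x%:C] * poles_prod (z :: L) x 0) ^+ 2 =
   normc (f x) ^+ 2 + normc c ^+ 2 * normc (x%:C - z)^-1 ^+ 2 +
   2 * Re ((c *: map_poly (@conjc _) Q).[x%:C] * poles_prod (z :: L) x 0).
  by rewrite fE normcD_sqr (normcM c) exprMn gE crossE.
pose I' := \int[mu]_x (normc (f x) ^+ 2).
pose Ie := \int[mu]_x (normc (x%:C - z)^-1 ^+ 2).
have I'E : (\int[mu]_x (normc (f x) ^+ 2)%:E)%E = I'%:E.
  by rewrite fineK// integrable_fin_num.
have IeE : (\int[mu]_x (normc (x%:C - z)^-1 ^+ 2)%:E)%E = Ie%:E.
  by rewrite fineK// integrable_fin_num.
have igc : mu.-integrable setT (fun x => (normc c ^+ 2 * normc (x%:C - z)^-1 ^+ 2)%:E).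
  by under eq_fun do rewrite EFinM; exact: integrableZl.
have ixc : mu.-integrable setT (fun x => (2 * Re ((c *: map_poly (@conjc _) Q).[x%:C] *
     poles_prod (z :: L) x 0))%:E).
  by under eq_fun do rewrite EFinM; exact: integrableZl.
have tot : mu.-integrable setT (fun x => (normc (P.[x%:C] * poles_prod (z :: L) x 0) ^+ 2)%:E) /\
  (\int[mu]_x (normc (P.[x%:C] * poles_prod (z :: L) x 0) ^+ 2)%:E = (I' + normc c ^+ 2 * Ie)%:E)%E.
  under eq_fun do rewrite sqE !EFinD.
  split; first by apply: integrableD => //; apply: integrableD.
  rewrite integralD//; last by apply: integrableD.
  rewrite integralD//= I'E.
  under [X in (_ + X + _)%E]eq_integral do rewrite EFinM.
  under [X in (_ + _ + X)%E]eq_integral do rewrite EFinM.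
  by rewrite !integralZl// IeE Ix mule0 adde0.
have [tot1 tot2] := tot; split=> // x.
rewrite tot2 -EFinM lee_fin fE Im_poles_sum.
(* The Poisson kernel of [z] has mass at least pi, which is where the 1 / pi of the bound comes
   from. *)
have hIe : pi / Im z <= Ie.
  have := integral_cauchy_kernel (Re z) b0.
  under eq_integral do rewrite -normc_pole_sqr.
  by rewrite IeE lee_fin.
have pi0 := pi_gt0 R.
have S0 := Im_poles_sum_ge0 x Le.
have := hQ x; rewrite -/(f x) I'E -EFinM lee_fin => hfx.
apply: (@le_trans _ _ ((normc (f x) + normc (c * g x)) ^+ 2)).
  by rewrite lerXn2r ?nnegrE ?addr_ge0 ?normc_ge0 ?le_normcD.
have -> : (Im z * normc (x%:C - z)^-1 ^+ 2 + Im (poles_sum L x 0)) / pi * (I' + normc c ^+ 2 * Ie) =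
  (Im (poles_sum L x 0) + Im z * normc (x%:C - z)^-1 ^+ 2) * (I' / pi + normc c ^+ 2 * Ie / pi).
  by ring.
apply: cauchy_schwarz2; rewrite ?normc_ge0//.
- rewrite divr_ge0 ?(ltW pi0)// Rintegral_ge0// => t _; exact: sqr_ge0.
- by rewrite mulr_ge0 ?sqr_ge0// ltW.
- rewrite divr_ge0 ?(ltW pi0)// mulr_ge0 ?sqr_ge0// Rintegral_ge0// => t _; exact: sqr_ge0.
- by rewrite mulrA mulrAC.
rewrite normcM exprMn gE.
have h1 : 1 <= Im z * Ie / pi.
  by rewrite ler_pdivlMr// mul1r -ler_pdivrMl// mulrC.
have -> : Im z * normc (x%:C - z)^-1 ^+ 2 * (normc c ^+ 2 * Ie / pi) =
  (Im z * Ie / pi) * (normc c ^+ 2 * normc (x%:C - z)^-1 ^+ 2) by ring.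
by rewrite ler_peMl// mulr_ge0 ?sqr_ge0.
Qed.

End fixed_depth.
End malmquist_takenaka.

(** * The one-sided bound *)

Section one_sided.
Local Open Scope complex_scope.
Variable R : realType.
Implicit Types (x y d e : R) (c l w z : R[i]) (L : seq R[i]) (P : {poly R[i]}).
Local Notation Re := complex.Re.
Local Notation Im := complex.Im.
Local Notation mu := (@lebesgue_measure R).

Lemma normcX w k : normc (w ^+ k) = normc w ^+ k.
Proof.
elim: k => [|k IH]; first by rewrite !expr0 normc1.
by rewrite !exprS normcM IH.
Qed.

Lemma poles_sum_cat L1 L2 x y :
  poles_sum (L1 ++ L2) x y = poles_sum L1 x y + poles_sum L2 x y.
Proof. by rewrite /poles_sum big_cat. Qed.

Lemma poles_prod_cat L1 L2 x y :
  poles_prod (L1 ++ L2) x y = poles_prod L1 x y * poles_prod L2 x y.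
Proof. by rewrite /poles_prod big_cat. Qed.

Section fixed_depth.
Variable e : R.
Hypothesis e0 : 0 < e.

Lemma poles_sum_rational L : poles_above e L ->
  exists2 S : {poly R[i]}, (size S <= size L)%N &
    forall x, poles_sum L x 0 = S.[x%:C] * poles_prod L x 0.
Proof.
elim: L => [_|z L IH /= /andP[le Le]].
  by exists 0; [rewrite size_poly0|move=> x; rewrite /poles_sum big_nil horner0 mul0r].
have [S sS hS] := IH Le.
exists (\prod_(l <- L) ('X - l%:P) + S * ('X - z%:P)).
  rewrite (leq_trans (size_polyD _ _))// geq_max size_prod_XsubC leqnn/=.
  rewrite (leq_trans (size_polyMleq _ _))// size_XsubC addn2/= ltnS.
  by [].
move=> x; have x0 := pole_neq0 e0 x le.
rewrite /poles_sum big_cons -/(poles_sum L x 0) hS hornerD hornerM hornerXsubC.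
rewrite /poles_prod big_cons -/(poles_prod L x 0) zeta0 mulrDl; congr (_ + _); last first.
  by rewrite mulrA mulfK// mulrAC mulrC mulrA.
rewrite horner_prod.
suff h : (\prod_(l <- L) ('X - l%:P).[x%:C]) * poles_prod L x 0 = 1.
  by rewrite mulrCA h mulr1.
elim: (L) Le => [_|l L' IH' /= /andP[le' /IH'{}IH']].
  by rewrite /poles_prod !big_nil mulr1.
rewrite /poles_prod !big_cons -/(poles_prod L' x 0) hornerXsubC zeta0 mulrACA IH' mulr1.
by rewrite divff// (pole_neq0 e0 x le').
Qed.

Definition repeat_poles (m : nat) L := flatten (nseq m L).

Lemma poles_sum_repeat m L x : poles_sum (repeat_poles m L) x 0 = poles_sum L x 0 *+ m.
Proof.
elim: m => [|m IH]; first by rewrite mulr0n /poles_sum big_nil.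
by rewrite /repeat_poles /= poles_sum_cat mulrS -/(repeat_poles m L) IH.
Qed.

Lemma poles_prod_repeat m L x : poles_prod (repeat_poles m L) x 0 = poles_prod L x 0 ^+ m.
Proof.
elim: m => [|m IH]; first by rewrite expr0 /poles_prod big_nil.
by rewrite /repeat_poles /= poles_prod_cat exprS -/(repeat_poles m L) IH.
Qed.

Lemma poles_above_repeat m L : poles_above e L -> poles_above e (repeat_poles m L).
Proof.
move=> Le; elim: m => [//|m IH].
by rewrite /poles_above /repeat_poles /= all_cat; apply/andP.
Qed.

Lemma size_repeat_poles m L : size (repeat_poles m L) = (m * size L)%N.
Proof.
elim: m => [//|m IH].
by rewrite /repeat_poles /= size_cat -/(repeat_poles m L) IH mulSn.
Qed.

(** The bound for a rational function with the repeated poles is applied to F^m. The sum over the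
    repeated list is m F, whence the factor m, and its squared modulus is |F|^(2m). *)
Lemma one_sided_even L m : poles_above e L -> (0 < size L)%N -> (0 < m)%N ->
  mu.-integrable setT (fun x => (normc (poles_sum L x 0) ^+ (2 * m))%:E) /\
  forall x, ((normc (poles_sum L x 0) ^+ (2 * m))%:E <=
    (m%:R * Im (poles_sum L x 0) / pi)%:E *
    \int[mu]_t (normc (poles_sum L t 0) ^+ (2 * m))%:E)%E.
Proof.
move=> Le L0 m0; have [S sS hS] := poles_sum_rational Le.
have sSm : (size (S ^+ m) <= size (repeat_poles m L))%N.
  rewrite size_repeat_poles (leq_trans (size_poly_exp_leq _ _))//.
  have : ((size S).-1 < size L)%N by case: (size S) sS => //.
  move=> h; rewrite mulnC; apply: (@leq_trans (m * (size S).-1 + m)%N).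
    by rewrite -addn1 leq_add2l.
  by rewrite -mulnSr leq_mul2l h orbT.
have E x : normc (poles_sum L x 0) ^+ (2 * m) =
  normc ((S ^+ m).[x%:C] * poles_prod (repeat_poles m L) x 0) ^+ 2.
  by rewrite poles_prod_repeat horner_exp -exprMn -hS normcX mulnC exprM.
have [i h] := rational_sup_bound e0 (poles_above_repeat m Le) sSm.
under eq_fun do rewrite E.
split=> // x.
rewrite E.
apply: le_trans (h x) _.
rewrite poles_sum_repeat.
have -> : Im (poles_sum L x 0 *+ m) = m%:R * Im (poles_sum L x 0).
  elim: (m) => [|k IH]; first by rewrite mulr0n mul0r.
  by rewrite mulrS cImD IH -natr1; ring.
exact: lexx.
Qed.

Lemma poles_sum_bracket L : poles_above e L ->
  exists2 C, 0 <= C & forall x y, - e < y ->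
    normc (poles_sum L x y) <= C * (1 + x ^+ 2) `^ (- 2^-1).
Proof.
elim: L => [_|l L IH /= /andP[le /IH[C C0 hC]]].
  by exists 0 => // x y _; rewrite /poles_sum big_nil normc0 mul0r.
exists (pole_const e l + C) => [|x y ye]; first by rewrite addr_ge0// pole_const_ge0.
rewrite /poles_sum big_cons (le_trans (le_normcD _ _))// mulrDl lerD ?hC//.
exact: pole_norm_bracket.
Qed.

Lemma poles_sum_ccontinuous L x y : poles_above e L -> - e < y ->
  ccontinuous_at (fun t => poles_sum L t y) x.
Proof.
move=> + ye; rewrite /poles_sum; elim: L => [_|l L IH /= /andP[le /IH{}IH]].
  by under eq_fun do rewrite big_nil; exact: ccontinuous_cst.
under eq_fun do rewrite big_cons; apply: ccontinuousD => //.
apply: ccontinuousV; first exact: (zeta_sub_neq0 e0 le).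
exact: (cderive_continuous (cderive_zeta_x l x y)).
Qed.

Lemma continuous_normc (f : R -> R[i]) : (forall x, ccontinuous_at f x) ->
  continuous (fun x => normc (f x)).
Proof.
move=> cf x; have [f1 f2] := cf x.
have -> : (fun x => normc (f x)) = Num.sqrt \o (fun x => Re (f x) ^+ 2 + Im (f x) ^+ 2).
  by apply/funext => t /=; rewrite /normc; case: (f t).
apply: continuous_comp; last exact: sqrt_continuous.
exact: (continuousD (continuousM f1 f1) (continuousM f2 f2)).
Qed.

Lemma measurable_normc_powR (f : R -> R[i]) (r : R) : (forall x, ccontinuous_at f x) ->
  measurable_fun setT (fun x => normc (f x) `^ r).
Proof.
move=> cf; apply: measurableT_comp (@measurable_powR R r) _.
exact: continuous_measurable_fun (continuous_normc cf).
Qed.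

Lemma integrable_normc_powR (f : R -> R[i]) (C r : R) :
  (forall x, ccontinuous_at f x) -> 0 <= C ->
  (forall x, normc (f x) <= C * (1 + x ^+ 2) `^ (- 2^-1)) -> 1 < r ->
  mu.-integrable setT (fun x => (normc (f x) `^ r)%:E).
Proof.
move=> cf C0 fC r1; have r2 : 2^-1 < r / 2 by lra.
apply: (le_integrable measurableT _ _ (integrable_bracket (C `^ r) r2)).
  by apply/measurable_EFinP; exact: measurable_normc_powR.
move=> x _ /=; rewrite lee_fin ger0_norm ?powR_ge0//.
rewrite ger0_norm ?mulr_ge0 ?powR_ge0//.
have -> : - (r / 2) = - 2^-1 * r by field.
rewrite powRrM -powRM ?powR_ge0//.
by apply: ge0_ler_powR; rewrite ?nnegrE ?normc_ge0 ?mulr_ge0 ?powR_ge0 ?fC//; lra.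
Qed.

Lemma integrable_poles_sum L r : poles_above e L -> 1 < r ->
  mu.-integrable setT (fun x => (normc (poles_sum L x 0) `^ r)%:E).
Proof.
move=> Le r1; have [C C0 hC] := poles_sum_bracket Le.
apply: (@integrable_normc_powR (fun x => poles_sum L x 0) C) => // x.
  exact: poles_sum_ccontinuous (eN0 e0).
exact: hC (eN0 e0).
Qed.

Lemma Im_poles_sum_gt0 L x y : poles_above e L -> (0 < size L)%N -> - e < y ->
  0 < Im (poles_sum L x y).
Proof.
move=> + + ye.
have pos l : 2 * e <= Im l -> 0 < Im (zeta x y - l)^-1.
  move=> le; have z0 := zeta_sub_neq0 e0 le x ye.
  rewrite cImV -mulNr divr_gt0 ?Re2Im2_gt0// cImD.
  have := pole_depth e0 le ye.
  by case: l {le z0} => a b /= h; move: e0 h => h1 h2; lra.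
case: L => // l L /= /andP[le Le] _.
rewrite /poles_sum big_cons cImD ltr_pwDl ?pos//.
elim: L Le => [_|l' L IH /= /andP[le' /IH{}IH]]; first by rewrite big_nil.
by rewrite big_cons cImD addr_ge0// ltW// pos.
Qed.

(** An absorption argument: the supremum M of |F|, known in advance to be finite and positive,
    appears on the right with exponent 2 m - p and on the left with 2 m - 1, so p - 1 remains after
    cancellation. *)
Lemma one_sided_bound L p m : poles_above e L -> 1 < p -> p / 2 <= m%:R ->
  forall x, normc (poles_sum L x 0) `^ (p - 1) <=
    m%:R / pi * (\int[mu]_t normc (poles_sum L t 0) `^ p)%R.
Proof.
move=> Le p1 pm.
set J := (\int[mu]_t _)%R.
have pi0 := pi_gt0 R.
have J0 : 0 <= J by apply: Rintegral_ge0 => t _; exact: powR_ge0.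
have p10 : p - 1 != 0 by rewrite gt_eqF//; lra.
have [L0|L0] := posnP (size L).
  move=> x; rewrite (size0nil L0) /poles_sum big_nil normc0 powR0//.
  by rewrite mulr_ge0// divr_ge0// ltW.
have m0 : (0 < m)%N by rewrite -(ltr0n R); lra.
have F0 x : 0 < normc (poles_sum L x 0).
  rewrite normc_gt0//; apply/eqP => h; have := Im_poles_sum_gt0 x Le L0 (eN0 e0).
  by rewrite h ltxx.
pose A := [set normc (poles_sum L x 0) | x in [set: R]].
have hA : has_sup A.
  split; first by exists (normc (poles_sum L 0 0)), 0.
  exists ((size L)%:R / e) => _ [x _ <-].
  exact: (poles_sum_bound e0 Le x (eN0 e0)).
pose M := sup A.
have FM x : normc (poles_sum L x 0) <= M.
  by apply: sup_upper_bound => //; exists x.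
have M0 : 0 < M by exact: lt_le_trans (F0 0) (FM 0).
have [_ hE] := one_sided_even Le L0 m0.
pose K := m%:R / pi * (M `^ (2 * m%:R - p) * J).
have K0 : 0 <= K by rewrite mulr_ge0 ?divr_ge0 ?(ltW pi0)// mulr_ge0 ?powR_ge0.
have ip := integrable_poles_sum Le p1.
have intle : (\int[mu]_t (normc (poles_sum L t 0) ^+ (2 * m))%:E <= (M `^ (2 * m%:R - p) * J)%:E)%E.
  have -> : (M `^ (2 * m%:R - p) * J)%:E =
      (\int[mu]_t ((M `^ (2 * m%:R - p))%:E * (normc (poles_sum L t 0) `^ p)%:E))%E.
    by rewrite integralZl// EFinM fineK// integrable_fin_num.
  apply: ge0_le_integral => //.
  - by move=> x _; rewrite lee_fin exprn_ge0 ?normc_ge0.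
  - by have [/measurable_int] := one_sided_even Le L0 m0.
  - by apply: emeasurable_funM => //; exact: measurable_int ip.
  - move=> x _; rewrite -EFinM lee_fin -(powR_mulrn _ (normc_ge0 _)).
    have -> : (2 * m)%:R = 2 * m%:R - p + p :> R by rewrite natrM; ring.
    rewrite [leLHS]powRD; last by rewrite (gt_eqF (F0 x)) implybT.
    rewrite ler_wpM2r ?powR_ge0//.
    by apply: ge0_ler_powR; rewrite ?nnegrE ?normc_ge0 ?(ltW M0) ?FM//; lra.
have h1 x : normc (poles_sum L x 0) `^ (2 * m%:R - 1) <= K.
  have c0 : 0 <= m%:R * Im (poles_sum L x 0) / pi.
    by rewrite divr_ge0 ?(ltW pi0)// mulr_ge0// (Im_poles_sum_ge0 e0).
  have c0E : (0%:E <= (m%:R * Im (poles_sum L x 0) / pi)%:E)%E by rewrite lee_fin.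
  have := le_trans (hE x) (lee_wpmul2l c0E intle).
  rewrite -EFinM lee_fin -(powR_mulrn _ (normc_ge0 _)) natrM => h.
  (* One power of |F| > 0 is traded for the factor Im F <= |F| on the right. *)
  rewrite -(ler_pM2r (F0 x)).
  have -> : normc (poles_sum L x 0) `^ (2 * m%:R - 1) * normc (poles_sum L x 0) =
      normc (poles_sum L x 0) `^ (2 * m%:R).
    rewrite mulrC mulr_powRB1 ?normc_ge0//.
    by have : 0 < m%:R :> R; rewrite ?ltr0n//; lra.
  apply: le_trans h _; rewrite /K.
  have -> : m%:R * Im (poles_sum L x 0) / pi * (M `^ (2 * m%:R - p) * J) =
    m%:R / pi * (M `^ (2 * m%:R - p) * J) * Im (poles_sum L x 0) by ring.
  by rewrite ler_wpM2l ?(le_trans _ (ler_norm_Im _))// ler_norm.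
have m1 : 0 < 2 * m%:R - 1 :> R.
  have : 1 <= m%:R :> R by rewrite ler1n.
  by lra.
have MK : M `^ (2 * m%:R - 1) <= K.
  have : M <= K `^ (2 * m%:R - 1)^-1.
    apply: ge_sup; first by exists (normc (poles_sum L 0 0)), 0.
    move=> _ [t _ <-].
    have -> : normc (poles_sum L t 0) =
        (normc (poles_sum L t 0) `^ (2 * m%:R - 1)) `^ (2 * m%:R - 1)^-1.
      by rewrite -powRrM divff ?gt_eqF// powRr1 ?normc_ge0.
    apply: ge0_ler_powR; rewrite ?nnegrE ?powR_ge0 ?invr_ge0 ?(ltW m1) ?K0 ?h1//.
  move=> /(ge0_ler_powR (ltW m1)); rewrite !nnegrE (ltW M0) powR_ge0 => /(_ isT isT).
  by rewrite -powRrM mulVf ?gt_eqF// powRr1.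
have Mp : M `^ (p - 1) <= m%:R / pi * J.
  rewrite -(ler_pM2r (powR_gt0 (2 * m%:R - p) M0)) -powRD; last by rewrite (gt_eqF M0) implybT.
  rewrite (_ : p - 1 + (2 * m%:R - p) = 2 * m%:R - 1); last by ring.
  by rewrite mulrAC -[leRHS]mulrA.
move=> x; apply: le_trans Mp.
by apply: ge0_ler_powR; rewrite ?nnegrE ?normc_ge0 ?(ltW M0) ?FM//; lra.
Qed.

End fixed_depth.
End one_sided.

(** * Powers of products of one-sided sums *)

Section power.
Local Open Scope complex_scope.
Variable R : realType.
Implicit Types (x y d e a : R) (c l w z : R[i]) (L : seq R[i]).
Local Notation Re := complex.Re.
Local Notation Im := complex.Im.
Local Notation mu := (@lebesgue_measure R).

Lemma Re_clog w : w != 0 -> Re (clog w) = ln (normc w).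
Proof.
move=> w0; rewrite /= -sqr_normcE expr2 lnM ?posrE ?normc_gt0//.
by field.
Qed.

Lemma normc_cexp w : normc (cexp w) = expR (Re w).
Proof.
rewrite /normc /= !exprMn -mulrDr cos2Dsin2 mulr1 sqrtr_sqr.
by rewrite ger0_norm// expR_ge0.
Qed.

Lemma Im_clog_bound w : `|Im (clog w)| < pi / 2.
Proof. by rewrite ltr_norml atan_gtNpi2 atan_ltpi2. Qed.

Lemma clog_polar w : 0 < Re w ->
  normc w * cos (Im (clog w)) = Re w /\ normc w * sin (Im (clog w)) = Im w.
Proof.
case: w => a b /= a0.
have s0 : 0 < Num.sqrt (1 + (b / a) ^+ 2) by rewrite sqrtr_gt0 ltr_pwDl ?sqr_ge0.
have nE : Num.sqrt (a ^+ 2 + b ^+ 2) = a * Num.sqrt (1 + (b / a) ^+ 2).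
  rewrite -[X in X * _](ger0_norm (ltW a0)) -sqrtr_sqr -sqrtrM ?sqr_ge0//.
  by congr Num.sqrt; field; rewrite gt_eqF.
have cE : Num.sqrt (a ^+ 2 + b ^+ 2) * cos (atan (b / a)) = a.
  by rewrite cos_atan nE mulfK ?gt_eqF.
split=> //.
have c0 : cos (atan (b / a)) != 0 by rewrite cos_atan gt_eqF// invr_gt0.
have -> : sin (atan (b / a)) = cos (atan (b / a)) * (b / a).
  have h : sin (atan (b / a)) / cos (atan (b / a)) = b / a := atanK (b / a).
  by rewrite -[LHS](divfK c0) h mulrC.
by rewrite [LHS]mulrA cE mulrC divfK// gt_eqF.
Qed.

(** Minus the derivative of [poles_sum L] in the variable [zeta x y]. *)
Definition poles_sqr_sum L x y : R[i] := \sum_(l <- L) (zeta x y - l)^-1 ^+ 2.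

Section fixed_depth.
Variable e : R.
Hypothesis e0 : 0 < e.

Lemma cderive_poles_sum_x L x y : poles_above e L -> - e < y ->
  is_cderive (fun t => poles_sum L t y) x (- poles_sqr_sum L x y).
Proof.
move=> + ye; rewrite /poles_sum /poles_sqr_sum; elim: L => [_|l L IH /= /andP[le /IH{}IH]].
  by under eq_fun do rewrite big_nil; rewrite big_nil oppr0; exact: cderive_cst.
under eq_fun do rewrite big_cons.
rewrite big_cons opprD; apply: cderiveD => //.
have z0 := zeta_sub_neq0 e0 le x ye.
apply: is_cderive_eq (cderiveV z0 (cderive_zeta_x l x y)) _.
by rewrite exprVn mulN1r.
Qed.

Lemma cderive_poles_sum_y L x y : poles_above e L -> - e < y ->
  is_cderive (poles_sum L x) y (- 'i * - poles_sqr_sum L x y).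
Proof.
move=> + ye; rewrite /poles_sqr_sum; elim: L => [_|l L IH /= /andP[le /IH{}IH]].
  have -> : poles_sum [::] x = fun=> 0 by apply/funext => t; rewrite /poles_sum big_nil.
  by rewrite big_nil oppr0 mulr0; exact: cderive_cst.
have -> : poles_sum (l :: L) x = fun t => (zeta x t - l)^-1 + poles_sum L x t.
  by apply/funext => t; rewrite /poles_sum big_cons.
rewrite big_cons opprD mulrDr; apply: cderiveD => //.
have z0 := zeta_sub_neq0 e0 le x ye.
apply: is_cderive_eq (cderiveV z0 (cderive_zeta_y l x y)) _.
by rewrite exprVn; ring.
Qed.

Lemma poles_sqr_sum_ccontinuous L x y : poles_above e L -> - e < y ->
  ccontinuous_at (fun t => poles_sqr_sum L t y) x.
Proof.
move=> + ye; rewrite /poles_sqr_sum; elim: L => [_|l L IH /= /andP[le /IH{}IH]].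
  by under eq_fun do rewrite big_nil; exact: ccontinuous_cst.
under eq_fun do rewrite big_cons expr2; apply: ccontinuousD => //.
have cz : ccontinuous_at (fun t => (zeta t y - l)^-1) x.
  apply: ccontinuousV; first exact: (zeta_sub_neq0 e0 le).
  exact: (cderive_continuous (cderive_zeta_x l x y)).
exact: ccontinuousM.
Qed.

(* Termwise, [Im (zeta - l)^-1] is [y + Im l >= e] times [|zeta - l|^-2]: the
   positivity of [Im F] thus bounds the logarithmic derivative of [F]. *)
Lemma poles_sqr_sum_le L x y : poles_above e L -> - e < y ->
  normc (poles_sqr_sum L x y) <= normc (poles_sum L x y) / e.
Proof.
move=> Le ye; apply: (@le_trans _ _ (Im (poles_sum L x y) / e)); last first.
  by rewrite ler_pM2r ?invr_gt0// (le_trans (ler_norm _))// ler_norm_Im.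
rewrite /poles_sqr_sum /poles_sum; elim: L Le => [_|l L IH /= /andP[le /IH{}IH]].
  by rewrite !big_nil normc0 mul0r.
rewrite !big_cons cImD mulrDl (le_trans (le_normcD _ _))// lerD//.
rewrite ler_pdivlMr// normcX cImV normcV exprVn sqr_normcE.
have z0 := Re2Im2_gt0 (zeta_sub_neq0 e0 le x ye).
rewrite mulrC -mulNr ler_pM2r ?invr_gt0// cImD.
have := pole_depth e0 le ye.
by case: l {le z0} => a b /= h; lra.
Qed.

Lemma poles_sum_depth L x y : poles_above e L -> - e < y ->
  normc (poles_sum L x y) <= (size L)%:R / (y + e).
Proof.
move=> + ye; rewrite /poles_sum; elim: L => [_|l L IH /= /andP[le /IH{}IH]].
  by rewrite big_nil normc0 mul0r.
rewrite big_cons -nat1r mulrDl mul1r (le_trans (le_normcD _ _))// lerD//.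
apply: le_trans (pole_norm_le e0 le x ye) _.
have := pole_depth e0 le ye => h.
by rewrite lef_pV2 ?posrE; move: e0 le ye h => *; lra.
Qed.

(** The factor - i carries the upper half-plane, where the sum takes its values, to the right
    half-plane, where [clog] is the logarithm. *)
Definition log_rotated L x y : R[i] := clog (- 'i * poles_sum L x y).

(** This is (- F G)^a, as (- i F) (- i G) = - F G; adding two logarithms avoids any cut for the
    product. *)
Definition holo_power a L1 L2 x y : R[i] :=
  cexp (a%:C * (log_rotated L1 x y + log_rotated L2 x y)).

Lemma cRe_scale a w : Re (a%:C * w) = a * Re w.
Proof. by case: w => u v; rewrite cReM /=; ring. Qed.

Lemma Re_rotated w : Re (- 'i * w) = Im w.
Proof. by case: w => u v; rewrite cReM /=; ring. Qed.

Lemma Im_rotated w : Im (- 'i * w) = - Re w.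
Proof. by case: w => u v; rewrite cImM /=; ring. Qed.

Lemma normc_rotated w : normc (- 'i * w) = normc w.
Proof. by rewrite /normc; case: w => u v /=; congr Num.sqrt; ring. Qed.

Section nonempty.
Variables L1 L2 : seq R[i].
Hypotheses (L1e : poles_above e L1) (L2e : poles_above e L2).
Hypotheses (L1_gt0 : (0 < size L1)%N) (L2_gt0 : (0 < size L2)%N).
Variable a : R.
Hypothesis a0 : 2^-1 < a.

Lemma poles_sum_neq0 L x y : poles_above e L -> (0 < size L)%N -> - e < y ->
  poles_sum L x y != 0.
Proof.
move=> Le L0 ye; apply/eqP => h.
by have := Im_poles_sum_gt0 e0 x Le L0 ye; rewrite h ltxx.
Qed.

Lemma normc_holo_power x y : - e < y ->
  normc (holo_power a L1 L2 x y) =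
  normc (poles_sum L1 x y) `^ a * normc (poles_sum L2 x y) `^ a.
Proof.
move=> ye; rewrite normc_cexp.
have n1 := normc_gt0 (poles_sum_neq0 x L1e L1_gt0 ye).
have n2 := normc_gt0 (poles_sum_neq0 x L2e L2_gt0 ye).
have r L : (- 'i * poles_sum L x y == 0) = (poles_sum L x y == 0).
  have i0 : ('i == 0 :> R[i]) = false by rewrite eq_complex /= oner_eq0 andbF.
  by rewrite mulf_eq0 oppr_eq0 i0.
rewrite cRe_scale cReD !Re_clog ?r ?poles_sum_neq0// !normc_rotated.
by rewrite /powR !gt_eqF// mulrDr expRD.
Qed.

Lemma log_holomorphic_holo_power : log_holomorphic (- e) (holo_power a L1 L2)
  (fun x y => - a%:C * (poles_sqr_sum L1 x y / poles_sum L1 x y +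
                        poles_sqr_sum L2 x y / poles_sum L2 x y)).
Proof.
have i0 : 'i != 0 :> R[i] by rewrite eq_complex /= oner_eq0 andbF.
have dx L x y : poles_above e L -> (0 < size L)%N -> - e < y ->
    is_cderive (fun t => log_rotated L t y) x (- (poles_sqr_sum L x y / poles_sum L x y)).
  move=> Le L0 ye; have F0 := poles_sum_neq0 x Le L0 ye.
  have h := cderiveM (cderive_cst (- 'i) x) (cderive_poles_sum_x x Le ye).
  have re : 0 < Re (- 'i * poles_sum L x y) by rewrite Re_rotated (Im_poles_sum_gt0 e0).
  apply: is_cderive_eq (cderive_log re h) _.
  by rewrite mul0r add0r; field; rewrite F0 i0.
have dy L x y : poles_above e L -> (0 < size L)%N -> - e < y ->
    is_cderive (log_rotated L x) y (- 'i * - (poles_sqr_sum L x y / poles_sum L x y)).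
  move=> Le L0 ye; have F0 := poles_sum_neq0 x Le L0 ye.
  have h := cderiveM (cderive_cst (- 'i) y) (cderive_poles_sum_y x Le ye).
  have re : 0 < Re (- 'i * poles_sum L x y) by rewrite Re_rotated (Im_poles_sum_gt0 e0).
  apply: is_cderive_eq (cderive_log re h) _.
  by rewrite mul0r add0r; field; rewrite F0 i0.
split=> x y ye.
- have h := cderive_exp (cderiveM (cderive_cst a%:C x)
    (cderiveD (dx L1 x y L1e L1_gt0 ye) (dx L2 x y L2e L2_gt0 ye))).
  by apply: is_cderive_eq h _; rewrite /holo_power; ring.
- have h := cderive_exp (cderiveM (cderive_cst a%:C y)
    (cderiveD (dy L1 x y L1e L1_gt0 ye) (dy L2 x y L2e L2_gt0 ye))).
  by apply: is_cderive_eq h _; rewrite /holo_power; ring.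
- apply: ccontinuousM; first exact: ccontinuous_cst.
  have c L : poles_above e L -> (0 < size L)%N ->
      ccontinuous_at (fun t => poles_sqr_sum L t y / poles_sum L t y) x.
    move=> Le L0; apply: ccontinuousM; first exact: poles_sqr_sum_ccontinuous.
    apply: ccontinuousV; first exact: poles_sum_neq0.
    exact: (poles_sum_ccontinuous e0).
  by apply: ccontinuousD; exact: c.
Qed.

(** Each of the two factors decays like (1 + x^2)^(- a / 2), so together they reach the exponent a >
    1/2; the logarithmic derivative is bounded by [poles_sqr_sum_le]. *)
Lemma integral_holo_power :
  mu.-integrable setT (fun x => (Re (holo_power a L1 L2 x 0))%:E) /\
  (\int[mu]_x (Re (holo_power a L1 L2 x 0))%:E = 0)%E.
Proof.
have [hx hy hM] := log_holomorphic_holo_power.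
have [C1 C10 hC1] := poles_sum_bracket e0 L1e.
have [C2 C20 hC2] := poles_sum_bracket e0 L2e.
have age0 : 0 <= a by move: a0 => h; lra.
apply: (@cauchy_half_plane _ _ _ (- e) a (C1 `^ a * C2 `^ a) (a * (e^-1 + e^-1)) a0 hx hy hM).
- move=> x y ye; rewrite normc_holo_power//.
  have -> : C1 `^ a * C2 `^ a * (1 + x ^+ 2) `^ (- a) =
      (C1 * (1 + x ^+ 2) `^ (- 2^-1)) `^ a * (C2 * (1 + x ^+ 2) `^ (- 2^-1)) `^ a.
    rewrite !powRM ?powR_ge0// -!powRrM mulrACA -powRD; last first.
      by rewrite (gt_eqF (bracket_gt0 x)) implybT.
    by congr (_ * _ `^ _); field.
  by apply: ler_pM; rewrite ?powR_ge0//; apply: ge0_ler_powR;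
    rewrite ?nnegrE ?normc_ge0 ?mulr_ge0 ?powR_ge0 ?hC1 ?hC2.
- move=> x y ye; rewrite normcM normcN normc_cReal ger0_norm// ler_wpM2l//.
  have b L : poles_above e L -> (0 < size L)%N ->
      normc (poles_sqr_sum L x y / poles_sum L x y) <= e^-1.
    move=> Le L0; rewrite normcM normcV ler_pdivrMr ?normc_gt0 ?poles_sum_neq0//.
    by rewrite mulrC poles_sqr_sum_le.
  by rewrite (le_trans (le_normcD _ _))// lerD ?b.
(* The shift [e - 1] restricts to depths with y + e > 1, where (y + e)^(2 a) >= y + e because 2 a >
   1. *)
- move=> x; apply: (@cvg_depth_invr _ (e - 1) ((size L1)%:R `^ a * (size L2)%:R `^ a)) => y ye.
  have ye' : - e < y by lra.
  have ye1 : 1 <= y + e by lra.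
  have ye0 : 0 < y + e by lra.
  rewrite (le_trans (ler_norm_Re _))// normc_holo_power//.
  apply: (@le_trans _ _ (((size L1)%:R / (y + e)) `^ a * ((size L2)%:R / (y + e)) `^ a)).
    by apply: ler_pM; rewrite ?powR_ge0//; apply: ge0_ler_powR;
      rewrite ?nnegrE ?normc_ge0 ?divr_ge0 ?(ltW ye0) ?poles_sum_depth.
  rewrite !powRM ?invr_ge0 ?(ltW ye0)// mulrACA ler_wpM2l ?mulr_ge0 ?powR_ge0//.
  have yi : 0 < (y + e)^-1 by rewrite invr_gt0.
  rewrite -powRD; last by rewrite (gt_eqF yi) implybT.
  rewrite -[(y + e)^-1]powR_inv1 ?(ltW ye0)// -powRrM mulN1r powRN.
  rewrite lef_pV2 ?posrE ?powR_gt0//; last by lra.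
  apply: (@le_trans _ _ (y + e)); first by lra.
  by apply: le1r_powR => //; move: a0 => h; lra.
- by rewrite oppr_lt0.
Qed.

End nonempty.
End fixed_depth.
End power.

(** It gives (1 + h) / 2 >= 1, which covers the case of rho without poles on one side of the
    line. *)
Lemma hilbert_const_ge1 (R : realType) (p : R) : 1 < p -> 1 <= hilbert_const p.
Proof.
move=> p1; rewrite /hilbert_const; have pi0 := pi_gt0 R.
case: (leP p 2) => [p2|p2].
  have h : pi / 4 <= pi / (2 * p) < pi / 2.
    apply/andP; split; first by rewrite ler_pM2l ?pi_gt0// lef_pV2 ?posrE//; lra.
    by rewrite ltr_pM2l ?pi_gt0// ltf_pV2 ?posrE//; lra.
  by apply: le_trans (tan_ge_piquarter h); move: h => /andP[h _]; lra.
have s0_gt0 : 0 < pi / (2 * p) by rewrite divr_gt0//; lra.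
have s0_lt : pi / (2 * p) < pi / 4 by rewrite ltr_pM2l ?pi_gt0// ltf_pV2 ?posrE//; lra.
rewrite /cot ler_pdivlMr; last by apply: sin_gt0_pi; apply/andP; split; lra.
by rewrite mul1r -cosBpihalf -cosN; apply: cos_nincr; lra.
Qed.

(** * Norm of the Riesz projections *)

Section projection.
Local Open Scope complex_scope.
Variable R : realType.
Implicit Types (x y d e a : R) (c l w z F G : R[i]) (L : seq R[i]).
Local Notation Re := complex.Re.
Local Notation Im := complex.Im.
Local Notation mu := (@lebesgue_measure R).

Lemma Re_cexp w : Re (cexp w) = expR (Re w) * cos (Im w). Proof. by []. Qed.

Lemma cIm_scale a w : Im (a%:C * w) = a * Im w.
Proof. by case: w => u v; rewrite cImM /=; ring. Qed.

Lemma normc_powR_sqr (p : R) w : normc w `^ p = (normc w ^+ 2) `^ (p / 2).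
Proof.
by rewrite -(powR_mulrn 2 (normc_ge0 w)) -powRrM; congr (_ `^ _); field.
Qed.

(* Here [|F - conj G|^2] and [|F + conj G|^2] are [2 |F G| (C +- cos t)], with [t]
   the argument of [- F * G], so the last term is harmonic in the lower half
   plane for [F] and [G] holomorphic there. *)
Lemma hilbert_pointwise (p : R) : 1 < p -> exists2 b, 0 <= b &
  forall F G, 0 < Im F -> 0 < Im G ->
  normc (F - conjc G) `^ p <= hilbert_const p `^ p * normc (F + conjc G) `^ p +
   b * Re (cexp ((p / 2)%:C * (clog (- 'i * F) + clog (- 'i * G)))).
Proof.
move=> p1; have [b b0 hb] := hilbert_const_inequality p1.
exists (2 `^ (p / 2) * b) => [|F G F0 G0]; first by rewrite mulr_ge0 ?powR_ge0.
have neq0 w : 0 < Im w -> w != 0.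
  by move=> w0; apply/eqP => h; move: w0; rewrite h ltxx.
have [r0 s0] := (normc_gt0 (neq0 _ F0), normc_gt0 (neq0 _ G0)).
have rF : 0 < Re (- 'i * F) by rewrite Re_rotated.
have rG : 0 < Re (- 'i * G) by rewrite Re_rotated.
have [cF sF] := clog_polar rF; have [cG sG] := clog_polar rG.
have bF := Im_clog_bound (- 'i * F); have bG := Im_clog_bound (- 'i * G).
have cosD_eq : normc F * normc G * cos (Im (clog (- 'i * F)) + Im (clog (- 'i * G))) = - Re (F * G).
  transitivity ((normc (- 'i * F) * cos (Im (clog (- 'i * F)))) * (normc (- 'i * G) * cos (Im (clog (- 'i * G))))
    - (normc (- 'i * F) * sin (Im (clog (- 'i * F)))) * (normc (- 'i * G) * sin (Im (clog (- 'i * G))))).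
    by rewrite !normc_rotated cosD; ring.
  by rewrite cF cG sF sG !Re_rotated !Im_rotated cReM; ring.
have ReW : Re (cexp ((p / 2)%:C * (clog (- 'i * F) + clog (- 'i * G)))) =
   (normc F * normc G) `^ (p / 2) * cos (p / 2 * (Im (clog (- 'i * F)) + Im (clog (- 'i * G)))).
  rewrite Re_cexp cIm_scale cRe_scale cReD cImD !Re_clog.
  - rewrite !normc_rotated powRM ?normc_ge0//.
    by rewrite /powR (gt_eqF r0) (gt_eqF s0) mulrDr expRD.
  - by apply: contraTneq rG => ->; rewrite ltxx.
  - by apply: contraTneq rF => ->; rewrite ltxx.
rewrite ReW.
move: cosD_eq; set t := _ + Im (clog (- 'i * G)) => cosE.
have tpi : `|t| <= pi by rewrite (le_trans (ler_normD _ _))// [leRHS]splitr lerD// ltW.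
pose r := normc F; pose s := normc G.
have rs0 : 0 < 2 * (r * s) by rewrite !mulr_gt0.
pose C := (r ^+ 2 + s ^+ 2) / (2 * (r * s)).
have C1 : 1 <= C.
  rewrite ler_pdivlMr// mul1r.
  by have := sqr_ge0 (r - s); rewrite sqrrB -mulr_natl; lra.
have CE : 2 * (r * s) * C = r ^+ 2 + s ^+ 2 by rewrite /C mulrC divfK ?gt_eqF.
have FGE : Re (conjc F * conjc G) = Re (F * G).
  by rewrite !cReM; case: (F) (G) => [? ?] [? ?] /=; ring.
have e1 : normc (F - conjc G) ^+ 2 = 2 * (r * s) * (C + cos t).
  rewrite normcD_sqr normcN normc_conj mulrN.
  have -> : Re (- (conjc F * conjc G)) = - Re (conjc F * conjc G) by case: (_ * _).
  by rewrite FGE mulrDr CE /r /s; lra.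
have e2 : normc (F + conjc G) ^+ 2 = 2 * (r * s) * (C - cos t).
  by rewrite normcD_sqr normc_conj FGE mulrBr CE /r /s; lra.
have Cp : 0 <= C + cos t by have := cos_geN1 t; lra.
have Cm : 0 <= C - cos t by have := cos_le1 t; lra.
rewrite !normc_powR_sqr e1 e2 (powRM _ (ltW rs0) Cp) (powRM _ (ltW rs0) Cm).
have -> : (2 * (r * s)) `^ (p / 2) = 2 `^ (p / 2) * (r * s) `^ (p / 2).
  by rewrite powRM// mulr_ge0 ?normc_ge0.
rewrite -/r -/s; set A := 2 `^ (p / 2); set B := (r * s) `^ (p / 2).
have AB0 : 0 <= A * B by rewrite mulr_ge0 ?powR_ge0.
have -> : hilbert_const p `^ p * (A * B * (C - cos t) `^ (p / 2)) + A * b * (B * cos (p / 2 * t)) =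
   A * B * (hilbert_const p `^ p * (C - cos t) `^ (p / 2) + b * cos (p / 2 * t)) by ring.
by rewrite ler_wpM2l// hb.
Qed.

Lemma projection_pointwise (p : R) : 1 < p -> exists c : R,
  forall F G, 0 < Im F -> 0 < Im G ->
  normc F `^ p <= ((1 + hilbert_const p) / 2) `^ p * normc (F + conjc G) `^ p +
   c * Re (cexp ((p / 2)%:C * (clog (- 'i * F) + clog (- 'i * G)))).
Proof.
move=> p1; have [b b0 hb] := hilbert_pointwise p1.
have h0 := hilbert_const_gt0 p1; set h := hilbert_const p in h0 hb *.
have h1 : 0 < 1 + h by lra.
pose K := ((1 + h) / 2) `^ p.
(* With weights 1 / (1 + h) and h / (1 + h), (X + Y) / 2 is (1 + h) / 2 times a convex combination
   of X and Y / h; by [hY], (Y / h)^p is at most X^p up to the harmonic term. *)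
pose w := (1 + h)^-1.
have w01 : 0 <= w <= 1.
  by rewrite /w invr_ge0 (ltW h1) invf_le1//; lra.
have wE : 1 - w = h * w by rewrite /w; field; rewrite gt_eqF.
exists (K * ((1 - w) * (b / h `^ p))) => F G F0 G0.
have := hb F G F0 G0; set W := Re _; set Y := normc (F - conjc G); set X := normc (F + conjc G) => hY.
have X0 : 0 <= X by exact: normc_ge0.
have Y0 : 0 <= Y / h by rewrite divr_ge0 ?normc_ge0// ltW.
have hp0 : 0 < h `^ p by rewrite powR_gt0.
have FXY : normc F <= (X + Y) / 2.
  rewrite ler_pdivlMr// mulrC.
  have -> : 2 * normc F = normc (2%:C * F) by rewrite normcM normc_cReal ger0_norm.
  have -> : 2%:C * F = (F + conjc G) + (F - conjc G).
    by apply/eqP; rewrite eq_complex; case: (F) (G) => [? ?] [? ?] /=; apply/andP; split; apply/eqP; ring.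
  exact: le_normcD.
have XYE : (X + Y) / 2 = (1 + h) / 2 * (w * X + (1 - w) * (Y / h)).
  by rewrite wE /w; field; rewrite !gt_eqF.
have p0 : 0 <= p by lra.
have conv0 : 0 <= w * X + (1 - w) * (Y / h).
  by move: w01 => /andP[wl wr]; rewrite addr_ge0// mulr_ge0// subr_ge0.
apply: (@le_trans _ _ (K * (w * X `^ p + (1 - w) * (Y / h) `^ p))).
  apply: (@le_trans _ _ (((X + Y) / 2) `^ p)).
    apply: ge0_ler_powR; rewrite ?nnegrE ?normc_ge0//.
    by rewrite divr_ge0// addr_ge0 ?normc_ge0.
  rewrite XYE powRM ?divr_ge0 ?(ltW h1)// ler_wpM2l ?powR_ge0//.
  exact: (powR_conv_le (ltW p1) w01).
have -> : K * X `^ p + K * ((1 - w) * (b / h `^ p)) * W =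
  K * (w * X `^ p + (1 - w) * (X `^ p + b / h `^ p * W)) by ring.
rewrite ler_wpM2l ?powR_ge0// lerD2l ler_wpM2l//; first by move: w01 => /andP[]; lra.
rewrite powRM ?normc_ge0 ?invr_ge0 ?(ltW h0)//.
rewrite -[h^-1]powR_inv1 ?(ltW h0)// -powRrM mulN1r powRN ler_pdivrMr//.
rewrite mulrDl mulrAC divfK ?gt_eqF// mulrC.
by rewrite mulrC (mulrC (X `^ p)).
Qed.

End projection.

Section two_sided.
Local Open Scope complex_scope.
Variable R : realType.
Implicit Types (x y d e a : R) (c l w z F G : R[i]) (L : seq R[i]).
Local Notation Re := complex.Re.
Local Notation Im := complex.Im.
Local Notation mu := (@lebesgue_measure R).

Definition two_sided_sum L1 L2 x : R[i] := poles_sum L1 x 0 + conjc (poles_sum L2 x 0).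

(** Conjugation exchanges the two halves, so a projection bound for one of them yields that for the
    other. *)
Lemma normc_two_sidedC L1 L2 x :
  normc (two_sided_sum L1 L2 x) = normc (two_sided_sum L2 L1 x).
Proof.
rewrite /two_sided_sum -normc_conj; congr normc.
by case: (poles_sum L1 x 0) (poles_sum L2 x 0) => [a b] [c d];
  apply/eqP; rewrite eq_complex /= addrC eqxx opprD opprK addrC eqxx.
Qed.

Section fixed_depth.
Variable e : R.
Hypothesis e0 : 0 < e.

Lemma two_sided_ccontinuous L1 L2 x : poles_above e L1 -> poles_above e L2 ->
  ccontinuous_at (two_sided_sum L1 L2) x.
Proof.
move=> L1e L2e; apply: ccontinuousD; first exact: poles_sum_ccontinuous (eN0 e0).
have [h1 h2] := poles_sum_ccontinuous e0 x L2e (eN0 e0).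
split.
  have -> : (fun s => Re (conjc (poles_sum L2 s 0))) = (fun s => Re (poles_sum L2 s 0)).
    by apply/funext => s; case: (poles_sum _ _ _).
  exact: h1.
have -> : (fun s => Im (conjc (poles_sum L2 s 0))) = (fun s => - Im (poles_sum L2 s 0)).
  by apply/funext => s; case: (poles_sum _ _ _).
exact: (continuousN h2).
Qed.

Lemma integrable_two_sided L1 L2 r : poles_above e L1 -> poles_above e L2 -> 1 < r ->
  mu.-integrable setT (fun x => (normc (two_sided_sum L1 L2 x) `^ r)%:E).
Proof.
move=> L1e L2e r1.
have [C1 C10 hC1] := poles_sum_bracket e0 L1e.
have [C2 C20 hC2] := poles_sum_bracket e0 L2e.
apply: (@integrable_normc_powR _ (two_sided_sum L1 L2) (C1 + C2)) => //.
- by move=> x; exact: two_sided_ccontinuous.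
- by rewrite addr_ge0.
move=> x; rewrite (le_trans (le_normcD _ _))// normc_conj mulrDl lerD//.
  exact: hC1 (eN0 e0).
exact: hC2 (eN0 e0).
Qed.

Lemma projection_integral L1 L2 p : poles_above e L1 -> poles_above e L2 -> 1 < p ->
  \int[mu]_x (normc (poles_sum L1 x 0) `^ p) <=
  ((1 + hilbert_const p) / 2) `^ p * \int[mu]_x (normc (two_sided_sum L1 L2 x) `^ p).
Proof.
move=> L1e L2e p1; have h1 := hilbert_const_ge1 p1.
set J := (X in _ <= _ * X).
have J0 : 0 <= J by apply: Rintegral_ge0 => x _; exact: powR_ge0.
have p0 : p != 0 by rewrite gt_eqF//; lra.
(* An empty sum is not in the open half-plane and has no logarithm. If [L1] is empty the left side
   is 0; if [L2] is empty both integrals agree. *)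
have [L10|L10] := posnP (size L1).
  rewrite (size0nil L10) [leLHS](_ : _ = 0) ?mulr_ge0 ?powR_ge0//.
  rewrite /Rintegral integral0_eq// => x _.
  by rewrite /poles_sum big_nil normc0 powR0.
have [L20|L20] := posnP (size L2).
  have -> : \int[mu]_x (normc (poles_sum L1 x 0) `^ p) = J.
    apply: eq_Rintegral => x _; rewrite /two_sided_sum (size0nil L20).
    by rewrite [poles_sum [::] _ _]/poles_sum big_nil conjc0 addr0.
  rewrite ler_peMl// -[leLHS](@powRr0 _ ((1 + hilbert_const p) / 2)) ler_powR//; lra.
have [c hc] := projection_pointwise p1.
have a1 : 2^-1 < p / 2 by lra.
have [iW IW] := integral_holo_power e0 L1e L2e L10 L20 a1.
have i1 := integrable_poles_sum e0 L1e p1.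
have i2 := integrable_two_sided L1e L2e p1.
pose K := ((1 + hilbert_const p) / 2) `^ p.
rewrite -lee_fin EFinM.
rewrite !fineK ?integrable_fin_num//.
apply: (@le_trans _ _ (\int[mu]_x ((K%:E * (normc (two_sided_sum L1 L2 x) `^ p)%:E) +
   (c%:E * (Re (holo_power (p / 2) L1 L2 x 0))%:E)))%E); last first.
  rewrite integralD//; [|exact: integrableZl|exact: integrableZl].
  by rewrite !integralZl// IW mule0 adde0.
apply: le_integral => //.
  by apply: integrableD => //; exact: integrableZl.
move=> x _; rewrite -!EFinM -EFinD lee_fin.
by apply: hc; exact: (Im_poles_sum_gt0 e0 _ _ _ (eN0 e0)).
Qed.

End fixed_depth.
End two_sided.

(** * Nikolskii inequality for two-sided sums *)

Section nikolskii.
Local Open Scope complex_scope.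
Variable R : realType.
Implicit Types (x y d e a : R) (L : seq R[i]).
Local Notation mu := (@lebesgue_measure R).
Variable e : R.
Hypothesis e0 : 0 < e.
Variables (p : R) (m : nat).
Hypotheses (p1 : 1 < p) (pm : p / 2 <= m%:R).
Variables L1 L2 : seq R[i].
Hypotheses (L1e : poles_above e L1) (L2e : poles_above e L2).

Let J := \int[mu]_x (normc (two_sided_sum L1 L2 x) `^ p).
Let K := ((1 + hilbert_const p) / 2) `^ p.

Let J_ge0 : 0 <= J.
Proof. by apply: Rintegral_ge0 => x _; exact: powR_ge0. Qed.

Let mpi_ge0 : 0 <= m%:R / pi :> R.
Proof. by rewrite divr_ge0// pi_ge0. Qed.

Let KJ_ge0 : 0 <= K * J. Proof. by rewrite mulr_ge0// powR_ge0. Qed.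

Let projection2 : \int[mu]_x (normc (poles_sum L2 x 0) `^ p) <= K * J.
Proof.
have -> : J = \int[mu]_x (normc (two_sided_sum L2 L1 x) `^ p).
  by apply: eq_Rintegral => x _; rewrite normc_two_sidedC.
exact: (projection_integral e0).
Qed.

Let half_sup L : poles_above e L ->
  \int[mu]_x (normc (poles_sum L x 0) `^ p) <= K * J ->
  forall x, normc (poles_sum L x 0) <= (m%:R / pi * (K * J)) `^ (p - 1)^-1.
Proof.
move=> Le LKJ x; have p0 : 0 < p - 1 by move: p1 => h; lra.
have h : normc (poles_sum L x 0) `^ (p - 1) <= m%:R / pi * (K * J).
  apply: le_trans (one_sided_bound e0 Le p1 pm x) _.
  exact: ler_wpM2l.
have -> : normc (poles_sum L x 0) = (normc (poles_sum L x 0) `^ (p - 1)) `^ (p - 1)^-1.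
  by rewrite -powRrM divff ?gt_eqF// powRr1 ?normc_ge0.
by apply: ge0_ler_powR; rewrite ?nnegrE ?powR_ge0 ?invr_ge0 ?(mulr_ge0 mpi_ge0) ?(ltW p0).
Qed.

(** Bounding |F|^q by (sup |F|)^(q - p) |F|^p and inserting [half_sup] gives [K * J] the exponent (q
    - p) / (p - 1) + 1 = (q - 1) / (p - 1). *)
Let half_power L q : poles_above e L -> p < q ->
  \int[mu]_x (normc (poles_sum L x 0) `^ p) <= K * J ->
  (\int[mu]_x (normc (poles_sum L x 0) `^ q)%:E <=
  ((m%:R / pi) `^ ((q - p) / (p - 1)) * (K * J) `^ ((q - 1) / (p - 1)))%:E)%E.
Proof.
move=> Le pq LKJ; have p0 : 0 < p - 1 by move: p1 => h; lra.
have q1 : 1 < q by apply: lt_trans pq.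
have [iq ip] := (integrable_poles_sum e0 Le q1, integrable_poles_sum e0 Le p1).
pose A := (m%:R / pi * (K * J)) `^ (p - 1)^-1.
have A0 : 0 <= A by exact: powR_ge0.
apply: (@le_trans _ _ (\int[mu]_x ((A `^ (q - p))%:E * (normc (poles_sum L x 0) `^ p)%:E))%E).
  apply: ge0_le_integral => //.
  - by move=> x _; rewrite lee_fin powR_ge0.
  - exact: measurable_int iq.
  - by apply: emeasurable_funM => //; exact: measurable_int ip.
  - move=> x _; rewrite -EFinM lee_fin.
    have -> : q = q - p + p by ring.
    rewrite [leLHS]powRD; last first.
      by rewrite subrK gt_eqF// (lt_trans _ q1).
    rewrite addrK ler_wpM2r ?powR_ge0//.
    by apply: ge0_ler_powR; rewrite ?nnegrE ?normc_ge0 ?half_sup ?subr_ge0 ?(ltW pq).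
rewrite integralZl// -[X in (_ * X)%E]fineK ?integrable_fin_num// -EFinM lee_fin.
apply: (@le_trans _ _ (A `^ (q - p) * (K * J))); first by rewrite ler_wpM2l ?powR_ge0.
(* Adding exponents requires a nonzero base, since 0 to the power 0 is 1. *)
have [->|KJ0] := eqVneq (K * J) 0; first by rewrite mulr0 mulr_ge0 ?powR_ge0.
rewrite /A -powRrM (powRM _ mpi_ge0 KJ_ge0) -mulrA.
have -> : (p - 1)^-1 * (q - p) = (q - p) / (p - 1) by rewrite mulrC.
rewrite -[X in _ * (_ * X)]powRr1// -powRD; last by rewrite KJ0 implybT.
rewrite (_ : (q - p) / (p - 1) + 1 = (q - 1) / (p - 1))//.
by field; rewrite gt_eqF.
Qed.

Lemma nikolskii_sup x : normc (two_sided_sum L1 L2 x) <=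
  2 * (m%:R / pi * (K * J)) `^ (p - 1)^-1.
Proof.
rewrite (le_trans (le_normcD _ _))// normc_conj mulr_natl mulr2n.
apply: lerD; last exact: (half_sup L2e projection2).
exact: (half_sup L1e (projection_integral e0 L1e L2e p1)).
Qed.

(** By convexity |F + conj G|^q <= 2^(q - 1) (|F|^q + |G|^q). As both halves have the same bound,
    the total factor is 2^q, as the triangle inequality in L^q would give. *)
Lemma nikolskii_power (q : R) : p < q ->
  \int[mu]_x (normc (two_sided_sum L1 L2 x) `^ q) <=
  2 `^ q * ((m%:R / pi) `^ ((q - p) / (p - 1)) * (K * J) `^ ((q - 1) / (p - 1))).
Proof.
move=> pq; have q1 : 1 < q by apply: lt_trans pq.
set D := _ `^ _ * _ `^ _.
have D0 : 0 <= D by rewrite mulr_ge0 ?powR_ge0.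
have i12 := integrable_two_sided e0 L1e L2e q1.
have i1 := integrable_poles_sum e0 L1e q1.
have i2 := integrable_poles_sum e0 L2e q1.
have h1 := half_power L1e pq (projection_integral e0 L1e L2e p1).
have h2 := half_power L2e pq projection2.
rewrite -lee_fin fineK ?integrable_fin_num//.
apply: (@le_trans _ _ (\int[mu]_x ((2 `^ q / 2)%:E *
    ((normc (poles_sum L1 x 0) `^ q)%:E + (normc (poles_sum L2 x 0) `^ q)%:E)))%E).
  apply: ge0_le_integral => //.
  - by move=> x _; rewrite lee_fin powR_ge0.
  - exact: measurable_int i12.
  - apply: emeasurable_funM => //; apply: emeasurable_funD.
      exact: measurable_int i1.
    exact: measurable_int i2.
  - move=> x _; rewrite -EFinD -EFinM lee_fin.
    set u := normc (poles_sum L1 x 0); set v := normc (poles_sum L2 x 0).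
    have u0 : 0 <= u by exact: normc_ge0.
    have v0 : 0 <= v by exact: normc_ge0.
    have w01 : 0 <= (2^-1 : R) <= 1 by apply/andP; split; lra.
    have := powR_conv_le (ltW q1) w01 u0 v0.
    have -> : 2^-1 * u `^ q + (1 - 2^-1) * v `^ q = (u `^ q + v `^ q) / 2 by field.
    have -> : 2^-1 * u + (1 - 2^-1) * v = (u + v) / 2 by field.
    move=> h; apply: (@le_trans _ _ ((2 * ((u + v) / 2)) `^ q)).
      apply: ge0_ler_powR; rewrite ?nnegrE ?normc_ge0 ?mulr_ge0 ?addr_ge0 ?invr_ge0//.
        by apply: ltW; apply: lt_trans q1.
      by rewrite mulrC divfK// (le_trans (le_normcD _ _))// normc_conj.
    rewrite powRM ?mulr_ge0 ?addr_ge0 ?invr_ge0// -mulrA ler_wpM2l ?powR_ge0//.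
    by rewrite [leRHS]mulrC.
rewrite integralZl//; last exact: integrableD.
rewrite integralD//.
apply: (@le_trans _ _ ((2 `^ q / 2)%:E * (D%:E + D%:E))%E).
  by apply: lee_wpmul2l; [rewrite lee_fin divr_ge0 ?powR_ge0|exact: leeD].
have -> : 2 `^ q * D = 2 `^ q / 2 * (D + D) by field.
by rewrite -EFinD -EFinM lexx.
Qed.

End nikolskii.

(** * Real poles and the norms on the line *)

Section transfer.
Local Open Scope complex_scope.
Variable R : realType.
Implicit Types (x y d e a : R) (l w : R[i]) (L s : seq R[i]).
Local Notation Re := complex.Re.
Local Notation Im := complex.Im.
Local Notation mu := (@lebesgue_measure R).

Definition line_sum s x : R[i] := \sum_(l <- s) (x%:C - l)^-1.

Lemma rho_line_sum n (z : 'I_n -> R[i]) x :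
  rho z x%:C = line_sum [seq z k | k <- enum 'I_n] x.
Proof. by rewrite /rho /line_sum big_map big_enum. Qed.

Lemma poles_above_le e e' L : e <= e' -> poles_above e' L -> poles_above e L.
Proof.
move=> ee'; apply: sub_all => l; apply: le_trans.
by rewrite ler_wpM2l.
Qed.

(** For real x, 1 / (x - l) is the conjugate of 1 / (x - conj l), which reflects the lower poles
    into the upper half-plane. The margin [e] is the minimum of 1 and half the least |Im l|. *)
Lemma line_sum_two_sided s : all (fun l => Im l != 0) s ->
  exists e L1 L2, [/\ 0 < e, poles_above e L1, poles_above e L2 &
    forall x, line_sum s x = two_sided_sum L1 L2 x].
Proof.
elim: s => [_|l s IH /= /andP[l0 /IH[e [L1 [L2 [e0 h1 h2 E]]]]]].
  exists 1, [::], [::]; split=> // x.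
  by rewrite /line_sum /two_sided_sum /poles_sum !big_nil conjc0 addr0.
pose e' := Num.min e (`|Im l| / 2).
have e'0 : 0 < e' by rewrite lt_min e0 divr_gt0// normr_gt0.
have e'e : e' <= e by rewrite ge_min lexx.
have e'l : 2 * e' <= `|Im l|.
  by rewrite mulrC -ler_pdivlMr// ge_min lexx orbT.
have h1' := poles_above_le e'e h1; have h2' := poles_above_le e'e h2.
have [lp|ln] := lerP 0 (Im l).
  exists e', (l :: L1), L2; split=> //.
    by rewrite /poles_above /= -[Im l]ger0_norm ?e'l.
  move=> x; rewrite /line_sum big_cons -/(line_sum s x) E.
  by rewrite /two_sided_sum /poles_sum big_cons zeta0 addrA.
exists e', L1, (conjc l :: L2); split=> //.
  apply/andP; split=> //.
  have -> : Im (conjc l) = `|Im l| by rewrite ltr0_norm//; case: (l).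
  exact: e'l.
move=> x; rewrite /line_sum big_cons -/(line_sum s x) E.
rewrite /two_sided_sum /poles_sum big_cons zeta0 addrCA rmorphD fmorphV.
congr (_ + (_ + _)); congr _^-1.
by case: (l) => a b; apply/eqP; rewrite eq_complex /= !sub0r opprK eqxx /= eqxx.
Qed.

Definition cmeasurable (f : R -> R[i]) :=
  measurable_fun setT (fun x => Re (f x)) /\ measurable_fun setT (fun x => Im (f x)).

Lemma measurable_inv_ge0 (f : R -> R) : measurable_fun setT f -> (forall x, 0 <= f x) ->
  measurable_fun setT (fun x => (f x)^-1).
Proof.
move=> mf f0; under eq_fun do rewrite -powR_inv1//.
exact: measurableT_comp (@measurable_powR R (- 1)) mf.
Qed.

Lemma cmeasurable_line_sum s : cmeasurable (line_sum s).
Proof.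
rewrite /line_sum; elim: s => [|l s [IH1 IH2]].
  by split; under eq_fun do rewrite big_nil; exact: measurable_cst.
have mRe : measurable_fun setT (fun x => Re (x%:C - l)).
  rewrite (_ : (fun x => _) = (fun x => x - Re l)); first exact: measurable_funB.
  by apply/funext => x; rewrite cReD; case: (l).
have mIm : measurable_fun setT (fun x => Im (x%:C - l)).
  rewrite (_ : (fun x => _) = (fun=> - Im l)); first exact: measurable_cst.
  by apply/funext => x; rewrite cImD; case: (l) => a b /=; rewrite add0r.
have mD : measurable_fun setT (fun x => (Re (x%:C - l) ^+ 2 + Im (x%:C - l) ^+ 2)^-1).
  apply: measurable_inv_ge0 => [|x]; last by rewrite addr_ge0// sqr_ge0.
  by apply: measurable_funD; exact: measurable_funX.
split.
  under eq_fun do rewrite big_cons cReD cReV.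
  by apply: measurable_funD => //; apply: measurable_funM.
under eq_fun do rewrite big_cons cImD cImV -mulNr.
apply: measurable_funD => //; apply: measurable_funM => //.
exact: measurableT_comp.
Qed.

Lemma measurable_normc_cmeasurable (f : R -> R[i]) (r : R) : cmeasurable f ->
  measurable_fun setT (fun x => normc (f x) `^ r).
Proof.
move=> [f1 f2]; apply: measurableT_comp (@measurable_powR R r) _.
have -> : (fun x => normc (f x)) = (fun x => (Re (f x) ^+ 2 + Im (f x) ^+ 2) `^ 2^-1).
  apply/funext => x; rewrite powR12_sqrt ?addr_ge0 ?sqr_ge0//.
  by rewrite /normc; case: (f x).
apply: measurableT_comp (@measurable_powR R _) _.
by apply: measurable_funD; exact: measurable_funX.
Qed.

(* Near a real pole [x0] of multiplicity [N], the sum is [N / (x - x0) + O(1)]. *)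
Lemma line_sum_near_pole s (x0 : R) : exists (N : nat) (d B : R),
  [/\ 0 < d, 0 <= B, x0%:C \in s -> (0 < N)%N &
   forall x, x0 < x < x0 + d -> normc (line_sum s x - N%:R / (x%:C - x0%:C)) <= B].
Proof.
elim: s => [|l s [N [d [B [d0 B0 hN hB]]]]].
  exists 0%N, 1, 0; split=> // x _.
  by rewrite /line_sum big_nil mul0r subr0 normc0.
have [lx|lx] := eqVneq l x0%:C.
  exists N.+1, d, B; split=> // x /hB; congr (normc _ <= _).
  by rewrite /line_sum big_cons lx -[N.+1%:R]nat1r mulrDl mul1r; ring.
pose D := normc (x0%:C - l).
have D0 : 0 < D by rewrite normc_gt0// subr_eq0 eq_sym.
exists N, (Num.min d (D / 2)), (B + 2 / D); split=> [|||x /andP[x0x]].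
- by rewrite lt_min d0 divr_gt0.
- by rewrite addr_ge0// divr_ge0// ltW.
- by rewrite inE eq_sym (negPf lx).
rewrite -ltrBlDl lt_min => /andP[xd xD].
have h1 : normc (line_sum s x - N%:R / (x%:C - x0%:C)) <= B.
  by apply: hB; rewrite x0x/= -ltrBlDl.
have h2 : D / 2 <= normc (x%:C - l).
  have : D <= normc (x%:C - l) + normc (x0%:C - x%:C).
    rewrite /D (_ : x0%:C - l = (x%:C - l) + (x0%:C - x%:C)); last by ring.
    exact: le_normcD.
  rewrite -rmorphB normc_cReal distrC gtr0_norm ?subr_gt0//; lra.
rewrite /line_sum big_cons -/(line_sum s x) -addrA addrC.
rewrite (le_trans (le_normcD _ _))// lerD// normcV.
rewrite -[2 / D]invf_div lef_pV2 ?posrE ?divr_gt0//.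
by apply: lt_le_trans h2; rewrite divr_gt0.
Qed.

(** On an interval of length r to the right of the pole the sum is at least 1 / (2 r) in modulus.
    The integral thus exceeds r (2 r)^(-p), which is unbounded as r tends to 0 because p > 1. *)
Lemma integral_real_pole s (x0 p : R) : x0%:C \in s -> 1 < p ->
  (\int[mu]_x (normc (line_sum s x) `^ p)%:E = +oo)%E.
Proof.
move=> x0s p1; have [N [d [B [d0 B0 /(_ x0s) N0 hB]]]] := line_sum_near_pole s x0.
have mF : measurable_fun setT (fun x => (normc (line_sum s x) `^ p)%:E).
  by apply/measurable_EFinP; apply: measurable_normc_cmeasurable; exact: cmeasurable_line_sum.
have pos x : (0 <= (normc (line_sum s x) `^ p)%:E)%E by rewrite lee_fin powR_ge0.
(* Within [d1] of the pole half of the singular term exceeds [B + 1], so the other half survives the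
   bounded remainder. *)
pose d1 := Num.min d (2 * (B + 1))^-1.
have d10 : 0 < d1 by rewrite lt_min d0 invr_gt0; lra.
have big x : x0 < x < x0 + d1 -> (2 * (x - x0))^-1 <= normc (line_sum s x).
  move=> /andP[x0x xd1].
  move: xd1; rewrite -ltrBlDl lt_min => /andP[xd xB].
  have t0 : 0 < x - x0 by rewrite subr_gt0.
  have h : N%:R / (x - x0) <= normc (line_sum s x) + B.
    have -> : N%:R / (x - x0) = normc (N%:R / (x%:C - x0%:C)).
      rewrite normcM normcV -rmorphB normc_cReal (gtr0_norm t0); congr (_ / _).
      by rewrite -[N%:R in RHS](rmorph_nat (real_complex R)) normc_cReal ger0_norm.
    rewrite -[N%:R / _](subrK (line_sum s x)) addrC (le_trans (le_normcD _ _))// lerD2l.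
    by rewrite -normcN opprB; apply: hB; rewrite x0x/= -ltrBlDl.
  have h1 : (x - x0)^-1 <= N%:R / (x - x0).
    by rewrite ler_peMl ?invr_ge0 ?(ltW t0)// ler1n.
  have h2 : B + 1 < 2^-1 * (x - x0)^-1.
    have B1 : 0 < B + 1 by lra.
    rewrite -invfM -[ltLHS]invrK ltf_pV2 ?posrE ?invr_gt0 ?mulr_gt0//.
    by move: xB; rewrite invfM => xB; lra.
  by rewrite invfM; lra.
apply/eqP; rewrite -leye_eq leNgt; apply/negP => hlt.
have fin : (\int[mu]_x (normc (line_sum s x) `^ p)%:E)%E \is a fin_num.
  by rewrite ge0_fin_numE// integral_ge0.
set I := fine (\int[mu]_x (normc (line_sum s x) `^ p)%:E)%E.
have low (r : R) : 0 < r -> r < d1 -> r * ((2 * r)^-1) `^ p <= I.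
  move=> r0 rd; rewrite -lee_fin fineK//.
  have -> : (r * (2 * r)^-1 `^ p)%:E =
      (\int[mu]_(x in [set` `]x0, (x0 + r)[%R]) cst ((2 * r)^-1 `^ p)%:E x)%E.
    rewrite integral_cst//= lebesgue_measure_itv/= lte_fin ltrDl r0.
    by rewrite -EFinD -EFinM mulrC; congr (_ * _)%:E; ring.
  apply: (@le_trans _ _ (\int[mu]_(x in [set` `]x0, (x0 + r)[%R]) (normc (line_sum s x) `^ p)%:E)%E).
    apply: ge0_le_integral => //.
    - by move=> x _; rewrite lee_fin powR_ge0.
    - exact: measurable_funTS.
    - move=> x; rewrite /= in_itv/= => /andP[x0x xr]; rewrite lee_fin.
      have t0 : 0 < x - x0 by rewrite subr_gt0.
      apply: ge0_ler_powR; rewrite ?nnegrE ?normc_ge0 ?invr_ge0 ?mulr_ge0 ?(ltW r0)//; first by lra.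
      apply: le_trans (big x _); last by rewrite x0x/= (lt_trans xr)// ltrD2l.
      by rewrite lef_pV2 ?posrE ?mulr_gt0// ler_wpM2l//; lra.
  by apply: ge0_subset_integral.
have I0 : 0 <= I by rewrite fine_ge0// integral_ge0.
have I1 : 0 < 2 `^ p * (I + 1) by rewrite mulr_gt0 ?powR_gt0//; lra.
have p0 : 0 < p - 1 by lra.
have [A A0 hA] := powRN_small p0 (divr_gt0 ltr01 I1).
(* Small enough for r^(p - 1) <= 1 / (2^p (I + 1)), which lifts the lower bound to I + 1. *)
pose r := Num.min (d1 / 2) A^-1.
have r0 : 0 < r by rewrite lt_min invr_gt0 A0 divr_gt0.
have rd : r < d1 by rewrite gt_min; apply/orP; left; lra.
have hr : A <= r^-1 by rewrite -[leLHS]invrK lef_pV2 ?posrE ?invr_gt0// ge_min lexx orbT.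
have := hA _ hr; rewrite mul1r powRN.
have -> : (r^-1 `^ (p - 1))^-1 = r `^ (p - 1).
  by rewrite -powRN -[r^-1]powR_inv1 ?(ltW r0)// -powRrM mulN1r opprK.
move=> hr1; have := low r r0 rd.
have -> : r * (2 * r)^-1 `^ p = (2 `^ p * r `^ (p - 1))^-1.
  rewrite invfM powRM ?invr_ge0 ?(ltW r0)// -[2^-1]powR_inv1// -[r^-1]powR_inv1 ?(ltW r0)//.
  rewrite -!powRrM !mulN1r !powRN [RHS]invfM mulrCA; congr (_ * _).
  rewrite -powRN -[X in X * _](powRr1 (ltW r0)) -powRD ?(gt_eqF r0) ?implybT//.
  by rewrite -powRN; congr (_ `^ _); ring.
move=> h; have rp0 : 0 < 2 `^ p * r `^ (p - 1) by rewrite mulr_gt0 ?powR_gt0.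
have : I + 1 <= (2 `^ p * r `^ (p - 1))^-1.
  rewrite -[leLHS]invrK lef_pV2 ?posrE ?invr_gt0//; last by lra.
  rewrite -ler_pdivlMl ?powR_gt0//; apply: le_trans hr1 _.
  by rewrite invfM.
lra.
Qed.

Lemma Re_norm w : Re `|w| = normc w.
Proof. by rewrite normc_def /normc; case: w. Qed.

Lemma line_LnormE (q : \bar R) (f : R[i] -> R[i]) :
  line_Lnorm q f = Lnorm mu q (fun x => (normc (f x%:C))%:E).
Proof. by rewrite /line_Lnorm; congr Lnorm; apply/funext => x; rewrite Re_norm. Qed.

Lemma line_Lnorm_fin (r : R) (f : R[i] -> R[i]) : line_Lnorm r%:E f =
  ((\int[mu]_x (normc (f x%:C) `^ r)%:E) `^ r^-1)%E.
Proof.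
rewrite line_LnormE unlock; congr (_ `^ _)%E.
by apply: eq_integral => x _; rewrite abse_EFin ger0_norm ?normc_ge0.
Qed.

Lemma line_Lnorm_sup (B : R) (f : R[i] -> R[i]) : 0 <= B ->
  (forall x, normc (f x%:C) <= B) -> (line_Lnorm +oo f <= B%:E)%E.
Proof.
move=> B0 fB; rewrite line_LnormE unlock; case: ifP => _; last by rewrite lee_fin.
apply/ess_supP; apply: nearW => x.
by rewrite /= lee_fin ger0_norm ?normc_ge0.
Qed.

End transfer.

Section constants.
Variable R : realType.
Local Notation mu := (@lebesgue_measure R).
Local Open Scope complex_scope.

(** Since p / (p - 1) = p', the root of order p - 1 turns the projection constant into a power p'
    and J into the p-norm to the power p'. *)
Lemma nikolskii_constantE (p p' h J : R) : 1 < p -> p' = p / (p - 1) -> 0 <= h -> 0 <= J ->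
  ((((1 + h) / 2) `^ p) * J) `^ (p - 1)^-1 =
  2 `^ (- p') * (1 + h) `^ p' * J `^ (p^-1 * p').
Proof.
move=> p1 p'E h0 J0; have p0 : p - 1 != 0 by rewrite gt_eqF//; lra.
have pn0 : p != 0 by rewrite gt_eqF//; lra.
rewrite powRM ?powR_ge0// -powRrM -p'E.
have -> : p^-1 * p' = (p - 1)^-1 by rewrite p'E; field; rewrite p0 pn0.
rewrite powRM ?addr_ge0 ?invr_ge0// -[2^-1]powR_inv1// -powRrM mulN1r.
by rewrite (mulrC ((1 + h) `^ p')).
Qed.

(** The bound for finite q is put as a power q / q' = q - 1, so that the root giving the q-norm,
    raised to q', restores the constant of the theorem. The exponents agree through q' (q - 1) = q
    and p' q' (1/p - 1/q) (q - 1) = (q - p) / (p - 1). *)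
Lemma line_sum_bounds (s : seq R[i]) (p p' : R) (m : nat) :
  1 < p -> p' = p / (p - 1) -> p / 2 <= m%:R ->
  all (fun l => complex.Im l != 0) s ->
  let J := (\int[mu]_x (normc (line_sum s x) `^ p))%R in
  [/\ mu.-integrable setT (fun x => (normc (line_sum s x) `^ p)%:E),
   forall x, normc (line_sum s x) <=
    2 `^ (1 - p') * (m%:R / pi) `^ (p' * p^-1) * (1 + hilbert_const p) `^ p' * J `^ (p^-1 * p') &
   forall q q', p < q -> q' = q / (q - 1) ->
   (\int[mu]_x (normc (line_sum s x) `^ q)%:E <=
    ((2 `^ (q' - p') * (m%:R / pi) `^ (p' * q' * (p^-1 - q^-1)) * (1 + hilbert_const p) `^ p' *
      J `^ (p^-1 * p')) `^ (q / q'))%:E)%E].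
Proof.
move=> p1 p'E pm sn0 J.
have [e [L1 [L2 [e0 h1 h2 E]]]] := line_sum_two_sided sn0.
have h0 := ltW (hilbert_const_gt0 p1).
have p0 : p - 1 != 0 by rewrite gt_eqF//; lra.
have pn0 : p != 0 by rewrite gt_eqF//; lra.
have JE : J = \int[mu]_x (normc (two_sided_sum L1 L2 x) `^ p).
  by apply: eq_Rintegral => x _; rewrite E.
have J0 : 0 <= J by apply: Rintegral_ge0 => x _; exact: powR_ge0.
have mpi : 0 <= m%:R / pi :> R by rewrite divr_ge0// pi_ge0.
have KJ0 : 0 <= ((1 + hilbert_const p) / 2) `^ p * J by rewrite mulr_ge0// powR_ge0.
have cst := nikolskii_constantE p1 p'E h0 J0.
split.
- by under eq_fun do rewrite E; exact: (integrable_two_sided e0 h1 h2 p1).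
- move=> x; rewrite E; apply: le_trans (nikolskii_sup e0 p1 pm h1 h2 x) _.
  rewrite -JE (powRM _ mpi KJ0) cst powRD; last by rewrite pnatr_eq0 implybT.
  rewrite powRr1//.
  have -> : p' * p^-1 = (p - 1)^-1 by rewrite p'E; field; rewrite p0 pn0.
  by rewrite le_eqVlt; apply/orP; left; apply/eqP; ring.
- move=> q q' pq q'E.
  have q1 : 1 < q by apply: lt_trans pq.
  have q0 : q - 1 != 0 by rewrite gt_eqF//; lra.
  have qn0 : q != 0 by rewrite gt_eqF//; lra.
  have i12 := integrable_two_sided e0 h1 h2 q1.
  have := nikolskii_power e0 p1 pm h1 h2 pq.
  rewrite -JE => hq.
  have -> : (\int[mu]_x (normc (line_sum s x) `^ q)%:E)%E =
      (\int[mu]_x (normc (two_sided_sum L1 L2 x) `^ q))%:E.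
    by rewrite fineK ?integrable_fin_num//; apply: eq_integral => x _; rewrite E.
  rewrite lee_fin; apply: le_trans hq _; set X := m%:R / pi in mpi *.
  set Y := _ * J in KJ0 cst *.
  have -> : 2 `^ (q' - p') * X `^ (p' * q' * (p^-1 - q^-1)) * (1 + hilbert_const p) `^ p' *
      J `^ (p^-1 * p') = 2 `^ q' * (X `^ (p' * q' * (p^-1 - q^-1)) * Y `^ (p - 1)^-1).
    by rewrite cst powRD ?pnatr_eq0 ?implybT//; ring.
  have -> : q / q' = q - 1 by rewrite q'E; field; rewrite q0 qn0.
  rewrite (powRM _ (powR_ge0 2 q') (mulr_ge0 (powR_ge0 _ _) (powR_ge0 _ _))).
  rewrite (powRM _ (powR_ge0 X _) (powR_ge0 Y _)) -!powRrM.
  have -> : q' * (q - 1) = q by rewrite q'E; field.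
  have -> : p' * q' * (p^-1 - q^-1) * (q - 1) = (q - p) / (p - 1).
    by rewrite q'E p'E; field; rewrite p0 pn0 q0 qn0.
  by rewrite (mulrC _^-1).
Qed.

End constants.

Unset Implicit Arguments.

Theorem theorem4p5 (R : realType) (n : nat) (z : 'I_n -> R[i]%C)
    (p : R) (q : \bar R) (p' q' : R) (m : nat)
    (hp : 1 < p) (hpq : (p%:E < q)%E)
    (hp' : p^-1 + p'^-1 = 1)
    (hq' : (q^-1 + q'%:E^-1 = 1)%E)
    (hm : p / 2 <= m%:R < 1 + p / 2) :
  (line_Lnorm q (rho z) `^ q' <=
   (2 `^ (q' - p')
    * (m%:R / pi) `^ (p' * q' * (p^-1 - fine (q^-1)%E))
    * (1 + hilbert_const p) `^ p')%:E
   * line_Lnorm p%:E (rho z) `^ p')%E.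
Proof.
have /andP[pm _] := hm.
have p0 : p != 0 by rewrite gt_eqF//; lra.
have p10 : p - 1 != 0 by rewrite gt_eqF//; lra.
(* With 0^-1 = 0, the value p' = 0 would force p = 1. *)
have p'0 : p' != 0.
  apply/eqP => h; move: hp'; rewrite h invr0 addr0 => /(congr1 GRing.inv).
  by rewrite invrK invr1; lra.
have p'E : p' = p / (p - 1).
  have : p'^-1 = 1 - p^-1 by rewrite -hp'; ring.
  move=> /(congr1 GRing.inv); rewrite invrK => ->.
  by field; rewrite p10 p0.
have h0 := hilbert_const_gt0 hp.
have pi0 := pi_gt0 R.
have m0 : 0 < m%:R :> R by lra.
set c := _ * _ `^ p'.
have c0 : 0 < c.
  by rewrite !mulr_gt0 ?powR_gt0 ?divr_gt0//; lra.
pose s := [seq z k | k <- enum 'I_n].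
have intE r : (\int[@lebesgue_measure R]_x (normc (rho z (real_complex R x)) `^ r)%:E =
    \int[@lebesgue_measure R]_x (normc (line_sum s x) `^ r)%:E)%E.
  by apply: eq_integral => x _; rewrite rho_line_sum.
rewrite [in leRHS]line_Lnorm_fin intE.
(* A real pole makes the right side +oo: the p-norm is infinite, p' is not 0 and c > 0. *)
have [sn0|/allPn[l ls]] := boolP (all (fun l => complex.Im l != 0) s); last first.
  rewrite negbK => /eqP Iml.
  have lE : l = real_complex R (complex.Re l) by case: l Iml {ls} => a b /= ->.
  rewrite lE in ls; rewrite (integral_real_pole ls hp).
  rewrite poweRyr ?invr_neq0// poweRyr//.
  by rewrite gt0_muley ?lte_fin// leey.
have [ip hsup hpow] := line_sum_bounds hp p'E pm sn0.
set J := (\int[_]_x _)%R in hsup hpow.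
have -> : (\int[@lebesgue_measure R]_x (normc (line_sum s x) `^ p)%:E)%E = J%:E.
  by rewrite fineK// integrable_fin_num.
have J0 : 0 <= J by apply: Rintegral_ge0 => x _; exact: powR_ge0.
rewrite !poweR_EFin -EFinM -powRrM.
case: q @c c0 hpq hq' hpow => [q||//] c c0 hpq hq' hpow; last first.
  have q'E : q' = 1.
    (* The extended inverse of 0 is +oo, so the equation rules out q' = 0. *)
    move: hq'; rewrite invey add0e inver; case: ifP => // _ [] h.
    by rewrite -[q']invrK h invr1.
  rewrite /c q'E poweRe1; last by rewrite line_LnormE; exact: Lnorm_ge0.
  apply: line_Lnorm_sup.
    by rewrite !mulr_ge0 ?powR_ge0.
  move=> x; rewrite rho_line_sum (le_trans (hsup x))//.
  by rewrite invey/= subr0 mulr1.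
rewrite lte_fin in hpq.
have q1 : 1 < q by apply: lt_trans hpq.
have q0 : q != 0 by rewrite gt_eqF//; lra.
have q10 : q - 1 != 0 by rewrite gt_eqF//; lra.
move: hq'; rewrite !inver (negPf q0); case: ifP => // q'0 [] hq'.
have q'E : q' = q / (q - 1).
  have : q'^-1 = 1 - q^-1 by rewrite -hq'; ring.
  move=> /(congr1 GRing.inv); rewrite invrK => ->.
  by field; rewrite q10 q0.
have q'_gt0 : 0 < q' by rewrite q'E divr_gt0//; lra.
rewrite line_Lnorm_fin intE -poweRrM.
have cE : c = 2 `^ (q' - p') * (m%:R / pi) `^ (p' * q' * (p^-1 - q^-1)) *
   (1 + hilbert_const p) `^ p' by rewrite /c inver (negPf q0).
have D0 : 0 <= c * J `^ (p^-1 * p') by rewrite mulr_ge0 ?powR_ge0// ltW.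
have := hpow q q' hpq q'E; rewrite -cE => hD.
have -> : (c * J `^ (p^-1 * p'))%:E = ((((c * J `^ (p^-1 * p')) `^ (q / q'))%:E) `^ (q^-1 * q'))%E.
  rewrite poweR_EFin -powRrM (_ : q / q' * (q^-1 * q') = 1) ?powRr1//.
  by field; rewrite q0 gt_eqF.
apply: gt0_ler_poweR => //.
- by rewrite mulr_ge0 ?invr_ge0 ?(ltW q'_gt0)//; lra.
- by rewrite in_itv/= leey andbT integral_ge0// => x _; rewrite lee_fin powR_ge0.
- by rewrite in_itv/= leey andbT lee_fin powR_ge0.
Qed.
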